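(* Let $(X,d,\mu)$ be a complete, doubling metric measure space supporting a $(1,1)$-Poincaré inequality. Let $0<\theta<1$ and $1\le q\le Q_d/(Q_d-\theta)$, where $Q_d>1$ is the relative lower mass bound exponent of $\mu$. Then there exist constants $C\ge 1$ and $\tau\ge 1$, depending only on the doubling constant and the constants of the $(1,1)$-Poincaré inequality, such that for all measurable sets $E\subset X$ and all balls $B=B(x,r)\subset X$, $$\left(\frac{\min\{\mu(B\cap E),\,\mu(B\setminus E)\}}{\mu(B)}\right)^{1/q}\le C(1-\theta)\,r^\theta\,\frac{P_\theta(E,\tau B)}{\mu(\tau B)}.$$
   Context: A metric measure space $(X,d,\mu)$ is a metric space with a Borel regular outer measure $\mu$. Balls $B(x,r)=\{y\in X:d(x,y)<r\}$ are open and come with a prescribed center and radius; for $B=B(x,r)$, $\lambda B:=B(x,\lambda r)$ and $\mathrm{rad}(B):=r$. The measure $\mu$ is doubling with constant $C_\mu\ge1$ if $0<\mu(B(x,2r))\le C_\mu\,\mu(B(x,r))<\infty$ for all $x\in X$, $r>0$. We write $u_B=\frac1{\mu(B)}\int_B u\,d\mu$. Relative lower mass bound exponent: if $\mu$ is doubling there exist $C_0\ge1$ and $Q_d>1$, depending only on $C_\mu$, such that $\frac{\mu(B(y,r))}{\mu(B(x,R))}\ge C_0^{-1}\left(\frac rR\right)^{Q_d}$ for all $x\in X$, $0<r\le R<\infty$, $y\in B(x,R)$; $Q_d$ denotes this (fixed) exponent. A Borel function $g:X\to[0,\infty]$ is an upper gradient of $u:X\to[-\infty,\infty]$ if $|u(\gamma(b))-u(\gamma(a))|\le\int_\gamma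 g\,ds$ for all non-constant compact rectifiable curves $\gamma:[a,b]\to X$ (with $\int_\gamma g\,ds=\infty$ required if $u(\gamma(a))$ or $u(\gamma(b))$ is not finite). $(X,d,\mu)$ supports a $(1,1)$-Poincaré inequality if there are constants $C_P,\tau_P\ge1$ such that $\frac1{\mu(B)}\int_B|u-u_B|\,d\mu\le C_P\,\mathrm{rad}(B)\,\frac1{\mu(\tau_PB)}\int_{\tau_PB}g\,d\mu$ for every ball $B$, every $u\in L^1_{\mathrm{loc}}(X)$ and every upper gradient $g$ of $u$. For $0<\theta<1$, measurable $E\subset X$ and open $\Omega\subset X$, the fractional $\theta$-perimeter is $$P_\theta(E,\Omega)=\int_{\Omega\cap E}\int_{\Omega\setminus E}\frac{2}{d(x,y)^\theta[\mu(B(x,d(x,y)))+\mu(B(y,d(x,y)))]}\,d\mu(y)\,d\mu(x).$$ *)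

(* Defs.v *)
From HB Require Import structures.
From mathcomp Require Import all_boot all_order all_algebra.
From mathcomp Require Import all_classical all_reals all_analysis.
From mathcomp Require Import measurable_realfun.

Set Implicit Arguments.
Unset Strict Implicit.
Unset Printing Implicit Defensive.

Import Order.TTheory GRing.Theory Num.Theory.
Import numFieldNormedType.Exports.

Local Open Scope classical_set_scope.
Local Open Scope ring_scope.

(* Measurable types, hence [caratheodory_type] and integration, are pointed in
   MathComp-Analysis; so is [completeType]. *)
#[short(type="pointedMetricType")]
HB.structure Definition PointedMetric (K : numDomainType) :=
  {M of Metric K M & isPointed M}.

#[short(type="completeMetricType")]
HB.structure Definition CompleteMetric (K : numDomainType) :=
  {M of PointedMetric K M & Complete M}.

Section curves.
Context {R : realType} {X : metricType R}.
Implicit Types (gamma : R -> X) (a b s : R) (g u : X -> \bar R).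

Definition curve_variation gamma a b (p : seq R) : R :=
  let F := gamma \o nth b (a :: p) in
  \sum_(0 <= i < size p) mdist (F i) (F i.+1).

Definition curve_length gamma a b : \bar R :=
  ereal_sup [set (curve_variation gamma a b p)%:E | p in itv_partition a b].

Definition rectifiable_curve gamma a b : Prop :=
  [/\ a <= b, {within `[a, b], continuous gamma} &
      (curve_length gamma a b < +oo)%E].

Definition nonconstant_on gamma a b : Prop :=
  exists s t, [/\ s \in `[a, b], t \in `[a, b] & gamma s <> gamma t].

(* Arc-length parametrization on [0, curve_length gamma a b]. For a rectifiable
   curve some t in [a, b] has curve_length gamma a t = s, by continuity, and
   gamma takes the same value at all such t. *)
Definition arc_length_param gamma a b s : X :=
  gamma (xget a [set t | t \in `[a, b] /\ curve_length gamma a t = s%:E]).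

Definition curve_integral gamma a b g : \bar R :=
  (\int[lebesgue_measure]_(s in `[0%R, fine (curve_length gamma a b)]%classic)
     g (arc_length_param gamma a b s))%E.

End curves.

Section metric_measure_space.
Context {R : realType} {X : pointedMetricType R}.
Variable mu : {outer_measure set X -> \bar R}.
Local Open Scope ereal_scope.
Implicit Types (u g : X -> \bar R) (E Omega : set X).

(* The restriction of the outer measure to its Caratheodory-measurable sets. *)
Definition cara_measure : {measure set (caratheodory_type mu) -> \bar R} :=
  (mu : set (caratheodory_type mu) -> \bar R).

Definition borel : set (set X) := <<s [set A : set X | open A] >>.

Definition borel_regular : Prop :=
  (forall A, borel A -> mu.-cara.-measurable A) /\
  (forall A : set X, exists B, [/\ borel B, A `<=` B & mu A = mu B]).

Definition doubling (Cmu : R) : Prop :=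
  forall (x : X) (r : R), (0 < r)%R ->
    [/\ 0 < mu (ball x (2 * r)),
        mu (ball x (2 * r)) <= Cmu%:E * mu (ball x r) &
        Cmu%:E * mu (ball x r) < +oo].

Definition lower_mass_bound (C0 Q : R) : Prop :=
  forall (x y : X) (r rho : R), (0 < r)%R -> (r <= rho)%R -> ball x rho y ->
    (C0^-1 * (r / rho) `^ Q)%:E <= mu (ball y r) / mu (ball x rho).

Definition upper_gradient u g : Prop :=
  [/\ measurable_fun setT
        (g : g_sigma_algebraType [set A : set X | open A] -> \bar R),
      (forall x, 0 <= g x) &
      forall (gamma : R -> X) (a b : R),
        rectifiable_curve gamma a b -> nonconstant_on gamma a b ->
        (u (gamma a) \is a fin_num -> u (gamma b) \is a fin_num ->
           `|u (gamma b) - u (gamma a)| <= curve_integral gamma a b g) /\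
        (u (gamma a) \isn't a fin_num \/ u (gamma b) \isn't a fin_num ->
           curve_integral gamma a b g = +oo)].

Definition mean (B : set X) u : \bar R :=
  (\int[cara_measure]_(x in B) u x) / mu B.

Definition L1_loc u : Prop :=
  measurable_fun setT (u : caratheodory_type mu -> \bar R) /\
  forall x : X, exists2 r : R, (0 < r)%R &
    cara_measure.-integrable (ball x r) u.

Definition poincare11 (CP tauP : R) : Prop :=
  forall (x : X) (r : R) u g, (0 < r)%R -> L1_loc u -> upper_gradient u g ->
    mean (ball x r) (fun y => `|u y - mean (ball x r) u|) <=
      (CP * r)%:E * mean (ball x (tauP * r)) g.

Definition fractional_perimeter (theta : R) E Omega : \bar R :=
  \int[cara_measure]_(x in Omega `&` E)
  \int[cara_measure]_(y in Omega `\` E)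
    (2%:E / ((mdist (x : X) y `^ theta)%:E *
      (mu (ball (x : X) (mdist (x : X) y)) +
       mu (ball (y : X) (mdist (x : X) y))))).

End metric_measure_space.

(* C0 and Qd are given as functions of the doubling constant, since they depend
   on nothing else. *)
Definition relative_lower_mass_exponent (R : realType) (C0 Qd : R -> R) : Prop :=
  forall Cmu : R, 1 <= Cmu ->
    [/\ 1 <= C0 Cmu, 1 < Qd Cmu &
        forall (X : pointedMetricType R) (mu : {outer_measure set X -> \bar R}),
          borel_regular mu -> doubling mu Cmu ->
          lower_mass_bound mu (C0 Cmu) (Qd Cmu)].

(* Main.v *)
Require Import Defs.
From mathcomp Require Import all_boot all_order all_algebra.
From mathcomp Require Import all_classical all_reals all_analysis.
From mathcomp Require Import measurable_realfun.
From mathcomp Require Import lra ring.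

(** Write [nu] for the finite values of [mu].

    One scale. If [E] and its complement both have density at least [c] in
    [B = B(x, rho)] and [t <= rho], let [S] be the set of points around which
    [E] has density more than [1/2] at scale [t].  The function
    [u = max (0, 1 - d(., S) / t)] has upper gradient [1/t] times the indicator
    of an open set on which both [E] and its complement have density bounded
    below at scale [t], and [u] agrees with the indicator of [E] on [B] up to
    such points and a small remainder.  The Poincare inequality then yields
    [nu B <= C (rho / t) nu H], with [H] the set of points of [tau B] where both
    densities at scale [t] are bounded below.

    All scales. Near [H] the complement of [E] is dense and [E] has mass
    comparable to [nu H], so each dyadic scale [t = rho / 2^k] contributes
    [2^(k theta) 2^(-k) nu B / rho^theta] to [P_theta (E, tau B)], and summing
    over [k] gives [nu B <= C (1 - theta) rho^theta P_theta (E, tau B)].  For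
    [theta < 1/2] the scale [k = 0] alone suffices, which keeps the constant
    bounded as [theta] tends to [0].

    Exponent. Let [A] be the smaller of [E] and its complement in the ball.
    Points of [A] are centres of balls where both densities are bounded below,
    found by a stopping time over dyadic radii; points at which [A] stays sparse
    down to scale [s] have measure at most [C s^theta P_theta].  A Vitali
    selection of disjoint balls [tau B_i], the estimate above on each of them,
    the lower mass bound and [(sum a_i)^p <= sum a_i^p] for [p = 1 - theta / Q]
    give the claim.

    Integrals of non-negative functions are suprema over simple functions, so
    lower bounds for [P_theta] need neither measurability of the inner integral
    nor Fubini's theorem. *)

Set Implicit Arguments.
Unset Strict Implicit.
Unset Printing Implicit Defensive.

Import Order.TTheory GRing.Theory Num.Theory.
Import numFieldNormedType.Exports.

Local Open Scope classical_set_scope.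
Local Open Scope ring_scope.

(** * Length of curves *)

Section curve_length_theory.
Context {R : realType} {X : metricType R}.
Implicit Types (gamma : R -> X) (a b c s t : R) (p : seq R).

Fixpoint chain_length gamma a p : R :=
  if p is x :: p' then mdist (gamma a) (gamma x) + chain_length gamma x p' else 0.

Lemma curve_variationE gamma a b p :
  curve_variation gamma a b p = chain_length gamma a p.
Proof.
elim: p a => [|x p IH] a; rewrite /curve_variation /= ?big_nil//.
by rewrite big_nat_recl//= -IH.
Qed.

Lemma chain_length_ge0 gamma a p : 0 <= chain_length gamma a p.
Proof. by elim: p a => //= x p IH a; rewrite addr_ge0// mdist_ge0. Qed.

Lemma chain_length_cat gamma a p1 p2 : chain_length gamma a (p1 ++ p2) =
  chain_length gamma a p1 + chain_length gamma (last a p1) p2.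
Proof. by elim: p1 a => /= [a|x p IH a]; rewrite ?add0r// IH addrA. Qed.

(** Only the first term changes, by the triangle inequality. This serves both to insert a point into
    a partition and to move its first point. *)
Lemma chain_length_shift gamma a c p : chain_length gamma a p <=
  mdist (gamma a) (gamma c) + chain_length gamma c p.
Proof.
case: p => [|x p] /=; first by rewrite addr0 mdist_ge0.
by rewrite addrA lerD2r metric_triangle.
Qed.

Lemma curve_length_ge gamma a b p : itv_partition a b p ->
  ((chain_length gamma a p)%:E <= curve_length gamma a b)%E.
Proof. by move=> abp; apply: ereal_sup_ubound; exists p; rewrite ?curve_variationE. Qed.

Lemma curve_length_le gamma a b (M : \bar R) :
  (forall p, itv_partition a b p -> ((chain_length gamma a p)%:E <= M)%E) ->
  (curve_length gamma a b <= M)%E.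
Proof.
by move=> h; apply: ge_ereal_sup => _ [p /= abp <-]; rewrite curve_variationE; exact: h.
Qed.

Lemma curve_length_gt gamma a b (M : \bar R) : (M < curve_length gamma a b)%E ->
  exists2 p, itv_partition a b p & (M < (chain_length gamma a p)%:E)%E.
Proof.
by move=> /ereal_sup_gt[_ [p /= abp <-]]; rewrite curve_variationE; exists p.
Qed.

Lemma itv_partition_refl a : itv_partition a a [::].
Proof. by split => //=. Qed.

Lemma curve_lengthxx gamma a : curve_length gamma a a = 0%E.
Proof.
apply/eqP; rewrite eq_le; apply/andP; split.
  by apply: curve_length_le => p /itv_partitionxx ->.
exact: (@curve_length_ge gamma a a [::] (itv_partition_refl a)).
Qed.

Lemma curve_length_ge0 gamma a b : a <= b -> (0 <= curve_length gamma a b)%E.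
Proof.
rewrite le_eqVlt => /predU1P[->|ab]; first by rewrite curve_lengthxx.
apply: le_trans (curve_length_ge gamma (itv_partition1 ab)).
by rewrite lee_fin chain_length_ge0.
Qed.

Lemma curve_length_ge_mdist gamma a b : a <= b ->
  ((mdist (gamma a) (gamma b))%:E <= curve_length gamma a b)%E.
Proof.
rewrite le_eqVlt => /predU1P[->|ab]; first by rewrite mdistxx curve_lengthxx.
apply: le_trans (curve_length_ge gamma (itv_partition1 ab)).
by rewrite lee_fin /= addr0.
Qed.

Lemma curve_length_lel gamma a c b : a <= c -> c <= b ->
  (curve_length gamma a c <= curve_length gamma a b)%E.
Proof.
move=> ac; rewrite le_eqVlt => /predU1P[->//|cb].
apply: curve_length_le => p acp.
apply: le_trans (curve_length_ge gamma (itv_partition_cat acp (itv_partition1 cb))).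
by rewrite chain_length_cat lee_fin lerDl chain_length_ge0.
Qed.

Lemma curve_length_ler gamma a c b : a <= c -> c <= b ->
  (curve_length gamma c b <= curve_length gamma a b)%E.
Proof.
rewrite le_eqVlt => /predU1P[->//|ac] cb.
apply: curve_length_le => p cbp.
apply: le_trans (curve_length_ge gamma (itv_partition_cat (itv_partition1 ac) cbp)).
by rewrite lee_fin /= lerDr mdist_ge0.
Qed.

Definition len gamma a b : R := fine (curve_length gamma a b).

Lemma len_ge0 gamma a b : a <= b -> 0 <= len gamma a b.
Proof. by move=> ab; rewrite fine_ge0// curve_length_ge0. Qed.

Lemma within_continuous_mdist gamma a b c e :
  {within `[a, b], continuous gamma} -> c \in `[a, b] -> 0 < e ->
  exists2 d, 0 < d & forall x, x \in `[a, b] -> `|c - x| < d -> mdist (gamma c) (gamma x) < e.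
Proof.
move=> /subspace_continuousP gc cab e0.
have := gc c cab => /cvg_ballP/(_ e e0).
rewrite near_withinE => /nbhs_ballP[d /= d0 h]; exists d => // x xab xd.
by have := h x xd xab; rewrite ballEmdist.
Qed.

Section rectifiable.
Variables (gamma : R -> X) (a b : R).
Hypothesis fin_len : (curve_length gamma a b < +oo)%E.

Lemma curve_lengthE c d : a <= c -> c <= d -> d <= b ->
  curve_length gamma c d = (len gamma c d)%:E.
Proof.
move=> ac cd db; rewrite /len fineK// ge0_fin_numE ?curve_length_ge0//.
apply: le_lt_trans fin_len; apply: (@le_trans _ _ (curve_length gamma a d)).
  exact: curve_length_ler.
by apply: curve_length_lel => //; exact: le_trans cd.
Qed.

Lemma len_ge c d p : a <= c -> c <= d -> d <= b -> itv_partition c d p ->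
  chain_length gamma c p <= len gamma c d.
Proof.
by move=> ac cd db /(curve_length_ge gamma); rewrite curve_lengthE// lee_fin.
Qed.

Lemma len_ge_mdist c d : a <= c -> c <= d -> d <= b ->
  mdist (gamma c) (gamma d) <= len gamma c d.
Proof.
move=> ac cd db; have := curve_length_ge_mdist gamma cd.
by rewrite curve_lengthE// lee_fin.
Qed.

Lemma len_approx c d e : a <= c -> c <= d -> d <= b -> 0 < e ->
  exists2 p, itv_partition c d p & len gamma c d - e < chain_length gamma c p.
Proof.
move=> ac cd db e0; have [|p cdp] := @curve_length_gt gamma c d (len gamma c d - e)%:E.
  by rewrite curve_lengthE// lte_fin ltrBlDr ltrDl.
by rewrite lte_fin; exists p.
Qed.

Lemma len_superadd c d e : a <= c -> c <= d -> d <= e -> e <= b ->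
  len gamma c d + len gamma d e <= len gamma c e.
Proof.
move=> ac cd de eb; apply/ler_addgt0Pr => r r0.
have r20 : 0 < r / 2 by rewrite divr_gt0.
have [p1 h1 l1] := len_approx ac cd (le_trans de eb) r20.
have [p2 h2 l2] := len_approx (le_trans ac cd) de eb r20.
have := len_ge ac (le_trans cd de) eb (itv_partition_cat h1 h2).
rewrite chain_length_cat; case: h1 => _ /eqP ->; lra.
Qed.

Hypothesis gamma_cont : {within `[a, b], continuous gamma}.

(** Move the last point of a nearly optimal partition from [c] slightly to the left. Half of the gap
    [len gamma a c - M] pays for near-optimality, the other half for the displacement of [gamma]. *)
Lemma len_lt_left c M : a < c -> c <= b -> M < len gamma a c ->
  exists2 d, a <= d < c & M < len gamma a d.
Proof.
move=> ac cb Ml; set e := (len gamma a c - M) / 2.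
have e0 : 0 < e by rewrite divr_gt0// subr_gt0.
have [p] := len_approx (lexx a) (ltW ac) cb e0.
case/lastP: p => [/itv_partition_nil ac'|p c' [pa]]; first by rewrite ac' ltxx in ac.
rewrite last_rcons => /eqP c'c; rewrite {c'}c'c in pa * => lp.
move: pa; rewrite rcons_path => /andP[pa lastc].
have al : a <= last a p by apply: (@itv_partition_le _ _ a _ p); split.
have [|d d0 hd] := @within_continuous_mdist gamma a b c e gamma_cont _ e0.
  by rewrite in_itv/= (ltW ac).
pose m := Num.max (last a p) (c - d).
have mc : m < c by rewrite gt_max lastc/=; lra.
have lm : last a p <= m by rewrite le_max lexx.
have dm : c - d <= m by rewrite le_max lexx orbT.
pose x := (m + c) / 2.
have ax : a <= x by rewrite /x; lra.
have xc : x < c by rewrite /x; lra.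
have lx : last a p < x by rewrite /x; lra.
exists x; first by rewrite ax xc.
have px : itv_partition a x (rcons p x).
  by split; rewrite ?last_rcons// rcons_path pa.
apply: lt_le_trans (len_ge (lexx a) ax (le_trans (ltW xc) cb) px).
have : mdist (gamma c) (gamma x) < e.
  apply: hd; first by rewrite in_itv/= ax (le_trans (ltW xc)).
  by rewrite ger0_norm /x; lra.
move: lp; rewrite -!cats1 !chain_length_cat/= !addr0 (metric_sym (gamma c)).
have := metric_triangle (gamma (last a p)) (gamma x) (gamma c).
rewrite /e; lra.
Qed.

(** Moving the first point of a nearly optimal partition of [[c, b]] to the right shows that almost
    all the length remains after [d]; superadditivity leaves little for [[c, d]]. *)
Lemma len_small_right c e : a <= c -> c < b -> 0 < e ->
  exists2 d, c < d <= b & len gamma c d <= e.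
Proof.
move=> ac cb e0; have e20 : 0 < e / 2 by rewrite divr_gt0.
have [[/itv_partition_nil cb'|h p hp lp]] := len_approx ac (ltW cb) (lexx b) e20.
  by rewrite cb' ltxx in cb.
have [/=/andP[ch _] _] := hp.
have hb := itv_partition_le (itv_partition_cons hp).
have [|d d0 hd] := @within_continuous_mdist gamma a b c _ gamma_cont _ e20.
  by rewrite in_itv/= ac ltW.
pose m := Num.min h (c + d).
have cm : c < m by rewrite lt_min ch/=; lra.
have mh : m <= h by rewrite ge_min lexx.
have md : m <= c + d by rewrite ge_min lexx orbT.
pose x := (c + m) / 2.
have cx : c < x by rewrite /x; lra.
have xh : x < h by rewrite /x; lra.
have xb : x <= b by rewrite (le_trans (ltW xh)).
have ax : a <= x by rewrite (le_trans ac)// ltW.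
exists x; first by rewrite cx xb.
have px : itv_partition x b (h :: p).
  by have [/=/andP[_ ? ?]] := hp; split => //=; rewrite xh.
have := len_ge ax xb (lexx b) px.
have := len_superadd ac (ltW cx) xb (lexx b).
have : mdist (gamma c) (gamma x) < e / 2.
  apply: hd; first by rewrite in_itv/= ax xb.
  by rewrite ltr0_norm /x; lra.
have := chain_length_shift gamma c x (h :: p).
lra.
Qed.

(** Inserting [d] into a partition does not decrease its chain length, and the refined partition
    splits at [d]. *)
Lemma len_subadd c d e : a <= c -> c <= d -> d <= e -> e <= b ->
  len gamma c e <= len gamma c d + len gamma d e.
Proof.
move=> ac; rewrite le_eqVlt => /predU1P[-> de eb|cd].
  by rewrite lerDr len_ge0.
rewrite le_eqVlt => /predU1P[-> eb|de eb].
  by rewrite lerDl len_ge0.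
apply/ler_addgt0Pr => r r0.
have ce := lt_trans cd de.
have [p pce lp] := len_approx ac (ltW ce) eb r0.
have hL := itv_partitionLP cd de pce.
have hR := itv_partitionRP cd de pce.
have := len_ge ac (ltW cd) (le_trans (ltW de) eb) hL.
have := len_ge (le_trans ac (ltW cd)) (ltW de) eb hR.
suff : chain_length gamma c p <=
    chain_length gamma c (itv_partitionL p d ++ itv_partitionR p d).
  by rewrite chain_length_cat last_rcons; lra.
have sp : sorted <%O p by case: pce => /path_sorted.
have [dp|dp] := boolP (d \in p); first by rewrite -in_itv_partition.
rewrite {1}(notin_itv_partition sp dp) /itv_partitionL cat_rcons.
rewrite !chain_length_cat lerD2l /=.
exact: chain_length_shift.
Qed.

(** Take the supremum of the parameters reached with length at most [s]: [len_lt_left] excludes a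
    length above [s] there, [len_small_right] one below. *)
Lemma len_ivt s : a <= b -> 0 <= s <= len gamma a b ->
  exists2 t, t \in `[a, b] & len gamma a t = s.
Proof.
move=> ab /andP[s0 sL].
pose A := [set t | a <= t <= b /\ len gamma a t <= s].
have lenaa : len gamma a a = 0 by rewrite /len curve_lengthxx.
have Aa : A a by split; rewrite ?lexx ?ab// lenaa.
have Aub : ubound A b by move=> t [/andP[]].
have hsA : has_sup A by split; [exists a|exists b].
have At : a <= sup A by apply: ub_le_sup => //; exists b.
have tb : sup A <= b by apply: ge_sup => //; exists a.
exists (sup A); first by rewrite in_itv/= At tb.
apply/eqP; rewrite eq_le; apply/andP; split.
  rewrite leNgt; apply/negP => h.
  have [At'|At'] := eqVneq a (sup A); first by rewrite -At' lenaa ltNge s0 in h.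
  have [|d /andP[ad dsup] sd] := len_lt_left _ tb h; first by rewrite lt_neqAle At' At.
  have [x [/andP[ax xb] xs] dx] : exists2 x, A x & d < x.
    apply: contrapT => hA; have : sup A <= d; last by rewrite leNgt dsup.
    apply: ge_sup; first by exists a.
    by move=> x Ax; rewrite leNgt; apply/negP => dx; apply: hA; exists x.
  have := len_superadd (lexx a) ad (ltW dx) xb; have := len_ge0 gamma (ltW dx); lra.
rewrite leNgt; apply/negP => h.
have [tb'|tb'] := eqVneq (sup A) b; first by rewrite tb' ltNge sL in h.
have [|||d /andP[sd db] ld] := @len_small_right (sup A) (s - len gamma a (sup A)).
- by [].
- by rewrite lt_neqAle tb' tb.
- by rewrite subr_gt0.
have : d <= sup A.
  apply: ub_le_sup; first by exists b.
  split; first by rewrite db (le_trans At)// ltW.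
  have := len_subadd (lexx a) At (ltW sd) db; lra.
by rewrite leNgt sd.
Qed.

End rectifiable.

(* For a rectifiable curve the [xget] in [arc_length_param] never falls back on
   its default value, by the intermediate value property of the length. *)
Lemma arc_length_paramP gamma a b s : rectifiable_curve gamma a b ->
  0 <= s <= len gamma a b ->
  exists2 t, t \in `[a, b] & len gamma a t = s /\ arc_length_param gamma a b s = gamma t.
Proof.
move=> [ab gc fl] s0L; rewrite /arc_length_param.
case: xgetP => [t -> [tab tl]|none].
  by eexists; [exact: tab|split => //; rewrite /len tl].
have [t tab tl] := len_ivt fl gc ab s0L.
exfalso; apply: (none t); split => //.
move: tab; rewrite in_itv/= => /andP[at_ tb].
by rewrite (curve_lengthE fl)// tl.
Qed.

Lemma arc_length_param_lipschitz gamma a b s s' : rectifiable_curve gamma a b ->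
  0 <= s <= len gamma a b -> 0 <= s' <= len gamma a b ->
  mdist (arc_length_param gamma a b s) (arc_length_param gamma a b s') <= `|s - s'|.
Proof.
move=> rg hs hs'; have [ab gc fl] := rg.
have [t tab [tl ->]] := arc_length_paramP rg hs.
have [t' tab' [tl' ->]] := arc_length_paramP rg hs'.
rewrite -tl -tl'; move: tab tab'; rewrite !in_itv/= => /andP[h1 h2] /andP[h3 h4].
wlog tt' : t t' h1 h2 h3 h4 {tl tl'} / t <= t'.
  move=> H; have [/H|/ltW/H] := leP t t'; first exact.
  by rewrite metric_sym distrC; exact.
rewrite distrC; apply: le_trans (ler_norm _).
have := len_superadd fl (lexx a) h1 tt' h4; have := len_ge_mdist fl h1 tt' h4; lra.
Qed.

(** The parameter chosen for length 0 may differ from [a], but the curve does not move on an initial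
    piece of length 0. *)
Lemma arc_length_param0 gamma a b : rectifiable_curve gamma a b ->
  arc_length_param gamma a b 0 = gamma a.
Proof.
move=> rg; have [ab gc fl] := rg.
have [|t] := @arc_length_paramP _ _ _ 0 rg; first by rewrite lexx len_ge0.
rewrite in_itv/= => /andP[h1 h2] [tl ->]; apply/esym/mdist_positivity/eqP.
by rewrite eq_le mdist_ge0 andbT -[leRHS]tl (len_ge_mdist fl).
Qed.

Lemma arc_length_param_len gamma a b : rectifiable_curve gamma a b ->
  arc_length_param gamma a b (len gamma a b) = gamma b.
Proof.
move=> rg; have [ab gc fl] := rg.
have [|t] := @arc_length_paramP _ _ _ (len gamma a b) rg; first by rewrite lexx len_ge0.
rewrite in_itv/= => /andP[h1 h2] [tl ->]; apply/mdist_positivity/eqP.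
rewrite eq_le mdist_ge0 andbT (le_trans (len_ge_mdist fl h1 h2 (lexx b)))//.
have := len_superadd fl (lexx a) h1 h2 (lexx b); lra.
Qed.

End curve_length_theory.

(** * Integrals of non-measurable functions *)

Section integral_lower.
Import HBNNSimple.
Local Open Scope ereal_scope.
Context d (T : measurableType d) (R : realType) (m : {measure set T -> \bar R}).

Lemma ge0_le_integral_nomeas (D : set T) (f g : T -> \bar R) :
  (forall x, D x -> 0 <= f x) -> (forall x, D x -> f x <= g x) ->
  \int[m]_(x in D) f x <= \int[m]_(x in D) g x.
Proof.
move=> f0 fg; have g0 x : D x -> 0 <= g x by move=> Dx; exact: le_trans (f0 x Dx) (fg x Dx).
rewrite !ge0_integralE//; apply: le_ereal_sup => _ [h /= hf <-]; exists h => // x.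
apply: le_trans (hf x) _; rewrite /patch; case: ifPn => // /set_mem Dx; exact: fg.
Qed.

Lemma ge0_integral_subset_nomeas (A D : set T) (g : T -> \bar R) :
  A `<=` D -> (forall x, D x -> 0 <= g x) ->
  \int[m]_(x in A) g x <= \int[m]_(x in D) g x.
Proof.
move=> AD g0; rewrite !ge0_integralE//; last by move=> x /AD; exact: g0.
apply: le_ereal_sup => _ [h /= hf <-]; exists h => // x.
apply: le_trans (hf x) _; rewrite /patch.
case: ifPn => [/set_mem/AD/mem_set ->//|_].
by case: ifPn => // /set_mem/g0.
Qed.

Lemma ge0_integral_ge_cst (A D : set T) (g : T -> \bar R) (c : R) :
  measurable A -> A `<=` D -> (forall x, D x -> 0 <= g x) ->
  (0 <= c)%R -> (forall x, A x -> c%:E <= g x) ->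
  c%:E * m A <= \int[m]_(x in D) g x.
Proof.
move=> mA AD g0 c0 cg; apply: le_trans (ge0_integral_subset_nomeas AD g0).
rewrite -integral_cst//; exact: ge0_le_integral_nomeas.
Qed.

Lemma integral_scale_indic (A D : set T) (c : R) :
  measurable A -> measurable D -> (0 <= c)%R ->
  \int[m]_(x in D) (c * \1_A x)%:E = c%:E * m (A `&` D).
Proof.
move=> mA mD c0; under eq_integral do rewrite EFinM.
rewrite ge0_integralZl// ?integral_indic//.
exact/measurable_EFinP/measurable_indic.
Qed.

(** A simple function below [f] on [A] and one below [f] on [B] add up to one below [f] on the
    union, because [A] and [B] are disjoint. *)
Lemma ge0_integralU_nomeas (A B : set T) (f : T -> \bar R) :
  A `&` B = set0 -> (forall x, (A `|` B) x -> 0 <= f x) ->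
  \int[m]_(x in A) f x + \int[m]_(x in B) f x <= \int[m]_(x in A `|` B) f x.
Proof.
move=> AB f0.
have fA x : A x -> 0 <= f x by move=> Ax; apply: f0; left.
have fB x : B x -> 0 <= f x by move=> Bx; apply: f0; right.
rewrite !ge0_integralE//; set M := (leRHS).
have key (h1 h2 : {nnsfun T >-> R}) : (forall x, (h1 x)%:E <= (f \_ A) x) ->
    (forall x, (h2 x)%:E <= (f \_ B) x) -> sintegral m h1 + sintegral m h2 <= M.
  move=> hA hB; rewrite -sintegralD//; apply: ereal_sup_ubound.
  exists (add_nnsfun h1 h2) => //= x; rewrite EFinD.
  have := leeD (hA x) (hB x); move/le_trans; apply; rewrite /patch in_setU.
  case: ifPn => [/set_mem Ax|_] /=; last by rewrite add0e.
  case: ifPn => [/set_mem Bx|_]; last by rewrite adde0.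
  by exfalso; have : set0 x by rewrite -AB.
(* If [M] is finite, so are both suprema, and they can be taken one after the other by subtracting a
   finite term. *)
have [->|Moo] := eqVneq M +oo; first by rewrite leey.
have le1 (h : {nnsfun T >-> R}) : (forall x, (h x)%:E <= (f \_ A) x) ->
    sintegral m h \is a fin_num.
  move=> hA; rewrite ge0_fin_numE ?sintegral_ge0//.
  have : M < +oo by rewrite ltey.
  apply: le_lt_trans; have := key h (nnsfun0 : {nnsfun T >-> R}) hA.
  rewrite sintegral0 adde0; apply => x.
  by rewrite /patch /=; case: ifPn => // /set_mem; exact: fB.
have step (h : {nnsfun T >-> R}) : (forall x, (h x)%:E <= (f \_ A) x) ->
    sintegral m h + ereal_sup [set sintegral m h2 | h2 in
      [set h2 : {nnsfun T >-> R} | forall x, (h2 x)%:E <= (f \_ B) x]] <= M.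
  move=> hA; rewrite addeC -leeBrDr ?le1//; apply: ge_ereal_sup => _ [h2 /= hB <-].
  by rewrite leeBrDr ?le1// addeC; exact: key.
set b := ereal_sup _ in step *.
have b0 : 0 <= b.
  apply: ereal_sup_ubound; exists nnsfun0; last exact: sintegral0.
  by move=> x; rewrite /patch /=; case: ifPn => // /set_mem; exact: fB.
have bfin : b \is a fin_num.
  rewrite ge0_fin_numE//; have : M < +oo by rewrite ltey.
  apply: le_lt_trans; have := step nnsfun0; rewrite sintegral0 add0e; apply => x.
  by rewrite /patch /=; case: ifPn => // /set_mem; exact: fA.
rewrite -leeBrDr//; apply: ge_ereal_sup => _ [h /= hA <-].
by rewrite leeBrDr//; exact: step.
Qed.

Lemma ge0_integral_disjoint_nomeas (I : eqType) (W : I -> set T) (s : seq I)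
    (D : set T) (f : T -> \bar R) :
  uniq s -> {in s &, forall i j, i != j -> W i `&` W j = set0} ->
  (forall i, i \in s -> W i `<=` D) -> (forall x, D x -> 0 <= f x) ->
  \sum_(i <- s) \int[m]_(x in W i) f x <= \int[m]_(x in D) f x.
Proof.
elim: s D => [|i s IH] D; first by move=> *; rewrite big_nil integral_ge0.
move=> /= /andP[is_ us] dW WD f0; rewrite big_cons.
have iD : W i `<=` D by apply: WD; rewrite mem_head.
rewrite -(setDUK iD); apply: le_trans (ge0_integralU_nomeas _ _); last 2 first.
- by rewrite setDIK.
- by rewrite setDUK.
rewrite leeD2l//; apply: IH => //.
- by move=> j k js ks; apply: dW; rewrite inE ?js ?ks orbT.
- move=> j js y Wjy; split; first by apply: (WD j) => //; rewrite inE js orbT.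
  move=> Wiy; have : (W j `&` W i) y by [].
  rewrite dW ?inE ?js ?eqxx ?orbT//; apply: contraNneq is_ => <-//.
- by move=> x [/f0].
Qed.

End integral_lower.

(** * A Lipschitz function and its upper gradient *)

Section truncated_distance.
Context {R : realType} {X : metricType R}.
Variables (S : set X) (t : R).
Hypothesis t0 : 0 < t.
Implicit Types (x y : X).

(** The supremum of these values is [max (0, 1 - d(x, S) / t)]. The adjoined 0 is the truncation and
    keeps the set nonempty when [S] is empty. *)
Let vals x := [set z : R | z = 0 \/ exists2 y, S y & z = 1 - mdist x y / t].

Definition tent x : R := sup (vals x).

Let vals1 x : ubound (vals x) 1.
Proof.
move=> z [->//|[y _ ->]]; rewrite gerBl.
by rewrite divr_ge0 ?mdist_ge0 ?ltW.
Qed.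

Lemma tent_le1 x : tent x <= 1.
Proof. by apply: ge_sup => //; exists 0; left. Qed.

Let le_tent x z : vals x z -> z <= tent x.
Proof. by move=> xz; apply: ub_le_sup => //; exists 1. Qed.

Lemma tent_ge0 x : 0 <= tent x. Proof. by apply: le_tent; left. Qed.

Lemma tent_eq1 x : S x -> tent x = 1.
Proof.
move=> Sx; apply/eqP; rewrite eq_le tent_le1; apply: le_tent; right.
by exists x => //; rewrite mdistxx mul0r subr0.
Qed.

Lemma tent_eq0 x : (forall y, S y -> t <= mdist x y) -> tent x = 0.
Proof.
move=> h; apply/eqP; rewrite eq_le tent_ge0 andbT; apply: ge_sup.
  by exists 0; left.
by move=> z [->//|[y /h ty ->]]; rewrite subr_le0 ler_pdivlMr// mul1r.
Qed.

Lemma tent_lipschitz x y : `|tent x - tent y| <= mdist x y / t.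
Proof.
wlog suff h : x y / tent x <= tent y + mdist x y / t.
  rewrite ler_norml; apply/andP; split; last by rewrite lerBlDl h.
  by have := h y x; rewrite metric_sym; lra.
apply: ge_sup; first by exists 0; left.
move=> z [->|[y' Sy' ->]]; first by rewrite addr_ge0 ?tent_ge0// divr_ge0 ?mdist_ge0 ?ltW.
have : 1 - mdist y y' / t <= tent y by apply: le_tent; right; exists y'.
suff : mdist y y' / t <= mdist x y / t + mdist x y' / t by lra.
by rewrite -mulrDl ler_pM2r ?invr_gt0// (metric_sym x y) metric_triangle.
Qed.

(** An open set off which the tent is constant on balls of radius [t]: at distance at least [2 * t]
    from [S] such a ball lies where the tent is 0, and if the ball is contained in [S] the tent is 1
    on it. *)
Definition tent_slope : set X :=
  [set x | (exists2 s, S s & mdist x s < 2 * t) /\ (exists2 y, ~ S y & mdist x y < t)].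

Lemma tent_locally_constant x y : ~ tent_slope x -> mdist x y < t -> tent x = tent y.
Proof.
move=> /not_andP[h xy|h xy].
  rewrite !tent_eq0// => s Ss; rewrite leNgt; apply/negP => ys; apply: h; exists s => //.
    have := metric_triangle x y s; lra.
  by move: ys t0; lra.
rewrite !tent_eq1//; apply: contrapT => nS; apply: h; [exists y|exists x] => //.
by rewrite mdistxx.
Qed.

Lemma open_tent_slope : open tent_slope.
Proof.
rewrite openE => x [[s Ss xs] [y Sy xy]].
pose e := Num.min (2 * t - mdist x s) (t - mdist x y).
have e0 : 0 < e by rewrite lt_min !subr_gt0 xs.
apply/nbhs_ballP; exists e => //= z; rewrite ballEmdist/= lt_min => /andP[zs zy].
split; [exists s|exists y] => //.
  have := metric_triangle z x s; rewrite (metric_sym z x); lra.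
have := metric_triangle z x y; rewrite (metric_sym z x); lra.
Qed.

Lemma tent_continuous : continuous tent.
Proof.
move=> x; apply/cvgrPdist_lt => e e0.
apply/nbhs_ballP; exists (e * t) => /=; first by rewrite mulr_gt0.
move=> y; rewrite ballEmdist/= => xy; apply: le_lt_trans (tent_lipschitz x y) _.
by rewrite ltr_pdivrMr.
Qed.

(** If some point of the arc is outside [tent_slope], both ends lie within [t] of it, because arc
    length bounds distance. *)
Lemma tent_step gamma a b p q : rectifiable_curve gamma a b ->
  0 <= p -> p <= q -> q <= len gamma a b -> q - p < t ->
  (forall s, p <= s <= q -> tent_slope (arc_length_param gamma a b s)) \/
  tent (arc_length_param gamma a b p) = tent (arc_length_param gamma a b q).
Proof.
move=> rg p0 pq qL qpt.
have [h|/existsNP[s /not_implyP[/andP[ps sq] ns]]] :=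
  pselect (forall s, p <= s <= q -> tent_slope (arc_length_param gamma a b s)).
  by left.
right; have L s' : p <= s' <= q -> mdist (arc_length_param gamma a b s)
     (arc_length_param gamma a b s') < t.
  move=> /andP[h1 h2]; apply: le_lt_trans (arc_length_param_lipschitz rg _ _) _.
  - by rewrite (le_trans p0 ps) (le_trans sq).
  - by rewrite (le_trans p0 h1) (le_trans h2).
  - by rewrite ltr_norml; apply/andP; split; lra.
rewrite -!(@tent_locally_constant (arc_length_param gamma a b s))//; apply: L.
- by rewrite pq lexx.
- by rewrite lexx pq.
Qed.

(** Cut the arc into pieces of length [eta] and let [W] collect those contained in [tent_slope].
    Across such a piece the tent changes by at most [eta / t]; on the others it takes equal values
    at the ends. *)
Lemma tent_arc_variation gamma a b (N : nat) (eta : R) :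
  rectifiable_curve gamma a b -> 0 <= eta < t -> N%:R * eta = len gamma a b ->
  forall n, (n <= N)%N -> exists W : set R,
    [/\ measurable W, W `<=` `[0, n%:R * eta],
        (forall s, W s -> tent_slope (arc_length_param gamma a b s)) &
        ((t * `|tent (arc_length_param gamma a b (n%:R * eta)) -
            tent (arc_length_param gamma a b 0)|)%:E <= lebesgue_measure W)%E].
Proof.
move=> rg /andP[eta0 etat] NL; elim=> [_|n IH nN].
  exists set0; split => //.
  by rewrite mul0r subrr normr0 mulr0 measure0.
have [W [mW W0 WG Wf]] := IH (ltnW nN).
have p0 : 0 <= n%:R * eta by rewrite mulr_ge0.
have nS : n.+1%:R * eta = n%:R * eta + eta by rewrite -natr1 mulrDl mul1r.
have qL : n.+1%:R * eta <= len gamma a b by rewrite -NL ler_wpM2r// ler_nat.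
have pq : n%:R * eta <= n.+1%:R * eta by rewrite nS lerDl.
have qp : n.+1%:R * eta - n%:R * eta < t by rewrite nS addrAC subrr add0r.
have [inG|eqf] := tent_step rg p0 pq qL qp; last first.
  exists W; split => //; last by rewrite -eqf.
  apply: subset_trans W0 _ => x /=; rewrite !in_itv/= => /andP[-> h].
  exact: le_trans pq.
(* The pieces are half-open so that the union is disjoint and the lengths add. *)
exists (W `|` `]n%:R * eta, n.+1%:R * eta]); split.
- by apply: measurableU => //; exact: measurable_itv.
- move=> x [/W0|] /=; rewrite !in_itv/= => /andP[h1 h2].
    by rewrite h1 (le_trans h2).
  by rewrite (le_trans p0 (ltW h1)).
- move=> s [/WG//|] /=; rewrite in_itv/= => /andP[h1 h2]; apply: inG.
  by rewrite ltW.
rewrite measureU//; last first.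
  rewrite -subset0 => x [/W0]/=; rewrite !in_itv/= => /andP[_ h] /andP[].
  by rewrite ltNge h.
apply: (@le_trans _ _ ((t * `|tent (arc_length_param gamma a b (n%:R * eta)) -
   tent (arc_length_param gamma a b 0)|)%:E + eta%:E)%E).
  rewrite -EFinD lee_fin.
  set f0 := tent (arc_length_param gamma a b 0).
  set f1 := tent (arc_length_param gamma a b (n%:R * eta)).
  set f2 := tent (arc_length_param gamma a b (n.+1%:R * eta)).
  have : `|f2 - f1| <= eta / t.
    apply: le_trans (tent_lipschitz _ _) _; rewrite ler_pM2r ?invr_gt0//.
    apply: le_trans (arc_length_param_lipschitz rg _ _) _.
    - by rewrite (le_trans p0 pq) qL.
    - by rewrite p0 (le_trans pq).
    - by rewrite nS addrAC subrr add0r ger0_norm.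
  rewrite ler_pdivlMr// mulrC => h.
  have := ler_normD (f2 - f1) (f1 - f0); rewrite addrA subrK => h'.
  apply: le_trans (ler_wpM2l (ltW t0) h') _; rewrite mulrDr; lra.
apply: leeD => //; rewrite /= lebesgue_measure_itv/= lte_fin nS ltrDl.
case: ltP => [e0|e0]; first by rewrite -EFinD addrAC subrr add0r.
by rewrite lee_fin.
Qed.

End truncated_distance.

Lemma tent_upper_gradient (R : realType) (X : pointedMetricType R) (S : set X) (t : R) :
  0 < t -> upper_gradient (EFin \o tent S t) (fun x => (t^-1 * \1_(tent_slope S t) x)%:E).
Proof.
move=> t0; split.
- apply/measurable_EFinP; apply: measurable_funM => //.
  apply: measurable_indic; apply: sub_sigma_algebra; exact: open_tent_slope.
- by move=> x; rewrite lee_fin indicE mulr_ge0 ?invr_ge0 ?ler0n ?ltW.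
- move=> gamma a b rg _; split; last by case.
  move=> _ _; have [ab gc fl] := rg.
  have L0 : 0 <= len gamma a b by exact: len_ge0.
  (* With this many pieces each has length less than [t]. *)
  pose N := (Num.truncn (len gamma a b / t)).+1.
  have N0 : 0 < N%:R :> R by rewrite ltr0n.
  pose eta := len gamma a b / N%:R.
  have eta0 : 0 <= eta by rewrite divr_ge0.
  have etat : eta < t.
    by rewrite ltr_pdivrMr// mulrC -ltr_pdivrMr// truncnS_gt.
  have NL : N%:R * eta = len gamma a b by rewrite mulrC divfK ?gt_eqF.
  have [|W [mW W0 WG]] := @tent_arc_variation R X S t t0 gamma a b N eta rg _ NL N (leqnn N).
    by rewrite eta0.
  rewrite NL in W0 *; rewrite arc_length_param_len// arc_length_param0// => Wf.
  apply: (@le_trans _ _ ((t^-1)%:E * lebesgue_measure W)%E); last first.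
    apply: ge0_integral_ge_cst => //.
    + by move=> x _; rewrite lee_fin indicE mulr_ge0 ?invr_ge0 ?ler0n ?ltW.
    + by rewrite invr_ge0 ltW.
    + by move=> s Ws; rewrite indicE mem_set ?mulr1//; exact: WG.
  rewrite -[leLHS]/(`|tent S t (gamma b) - tent S t (gamma a)|%:E).
  rewrite -[X in (X%:E <= _)%E](mulKf (lt0r_neq0 t0)) EFinM lee_pmul2l//.
  by rewrite lte_fin invr_gt0.
Qed.

(** * Doubling measures and Vitali covering *)

Section doubling_measure.
Context {R : realType} {X : pointedMetricType R}.
Variables (mu : {outer_measure set X -> \bar R}) (Cmu : R).
Hypothesis Cmu1 : 1 <= Cmu.
Hypothesis mu_reg : borel_regular mu.
Hypothesis mu_dbl : doubling mu Cmu.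
Implicit Types (x y z : X) (A B E : set X) (r s : R).

(** On subsets of balls this is the value of [mu]. Since [fine] sends [+oo] to 0, monotonicity and
    subadditivity below ask for an enclosing ball. *)
Definition nu A : R := fine (mu A).

Lemma ballP x r y : ball x r y <-> mdist x y < r.
Proof. by rewrite ballEmdist. Qed.

Lemma ball_sub x y r s : mdist x y + r <= s -> ball y r `<=` ball x s.
Proof.
move=> h z /ballP yz; apply/ballP; have := metric_triangle x y z; lra.
Qed.

Lemma ball_le0 x r : r <= 0 -> ball x r = set0.
Proof.
move=> r0; rewrite -subset0 => y /ballP; have := mdist_ge0 x y; lra.
Qed.

Lemma mu_ball_lty x r : (mu (ball x r) < +oo)%E.
Proof.
have [r0|r0] := ltP 0 r; last by rewrite ball_le0// outer_measure0.
have [_ _ h] := mu_dbl x r0; apply: le_lt_trans h.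
by rewrite lee_pemull// lee_fin.
Qed.

Lemma muE A x r : A `<=` ball x r -> mu A = (nu A)%:E.
Proof.
move=> AB; rewrite /nu fineK// ge0_fin_numE//.
by apply: le_lt_trans (mu_ball_lty x r); exact: le_outer_measure.
Qed.

Lemma mu_ballE x r : mu (ball x r) = (nu (ball x r))%:E.
Proof. exact: (@muE _ x r). Qed.

Lemma nu_ge0 A : 0 <= nu A. Proof. by apply: fine_ge0; exact: outer_measure_ge0. Qed.

Lemma nu0 : nu set0 = 0. Proof. by rewrite /nu outer_measure0. Qed.

Lemma nu_le A B x r : A `<=` B -> B `<=` ball x r -> nu A <= nu B.
Proof.
move=> AB Br; rewrite -lee_fin -(muE Br) -(muE (subset_trans AB Br)).
exact: le_outer_measure.
Qed.

Lemma nu_le_ball A x r : A `<=` ball x r -> nu A <= nu (ball x r).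
Proof. by move=> Ab; exact: (@nu_le _ _ x r Ab). Qed.

Lemma nuU A B x r : A `|` B `<=` ball x r -> nu (A `|` B) <= nu A + nu B.
Proof.
move=> h; rewrite -lee_fin EFinD -(muE h) -(@muE A x r) -?(@muE B x r).
- exact: outer_measureU2.
- by apply: subset_trans h => y; right.
- by apply: subset_trans h => y; left.
Qed.

Lemma nu_ball_gt0 x r : 0 < r -> 0 < nu (ball x r).
Proof.
move=> r0; have [|h _ _] := @mu_dbl x (r / 2); first by rewrite divr_gt0.
by move: h; rewrite mulrC divfK// mu_ballE lte_fin.
Qed.

Lemma nu_double x r : nu (ball x (2 * r)) <= Cmu * nu (ball x r).
Proof.
have [r0|r0] := ltP 0 r; last first.
  by rewrite !ball_le0 ?nu0 ?mulr0//; lra.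
by have [_ h _] := mu_dbl x r0; rewrite !mu_ballE -EFinM lee_fin in h.
Qed.

Lemma nu_ball_exp k x r s : s <= 2 ^+ k * r ->
  nu (ball x s) <= Cmu ^+ k * nu (ball x r).
Proof.
move=> sr; apply: (@le_trans _ _ (nu (ball x (2 ^+ k * r)))).
  by apply: nu_le_ball; apply: ball_sub; rewrite mdistxx add0r.
elim: k {sr} => [|k IH]; first by rewrite !expr0 !mul1r.
rewrite exprS -mulrA (le_trans (nu_double _ _))// exprS -mulrA ler_wpM2l//.
exact: le_trans ler01 Cmu1.
Qed.

Lemma nu_ball_le k x y r s : mdist x y + s <= 2 ^+ k * r ->
  nu (ball y s) <= Cmu ^+ k * nu (ball x r).
Proof.
move=> h; apply: le_trans (nu_ball_exp x (lexx (2 ^+ k * r))).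
by apply: nu_le_ball; exact: ball_sub.
Qed.

Lemma open_cara A : open A -> mu.-cara.-measurable A.
Proof. by move=> oA; apply: mu_reg.1; exact: sub_sigma_algebra. Qed.

Lemma open_metric_ball x r : open (ball x r).
Proof.
rewrite openE => y /ballP xy; apply/nbhs_ballP; exists (r - mdist x y) => /=.
  by rewrite subr_gt0.
by apply: ball_sub; lra.
Qed.

Lemma ball_cara x r : mu.-cara.-measurable (ball x r).
Proof. exact/open_cara/open_metric_ball. Qed.

Lemma nu_split A E x r : mu.-cara.-measurable E -> A `<=` ball x r ->
  nu A = nu (A `&` E) + nu (A `\` E).
Proof.
move=> mE Ab; apply: EFin_inj; rewrite EFinD -(muE Ab) -(@muE _ x r) -?(@muE (A `\` E) x r).
- by rewrite setDE; exact: mE.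
- by apply: subset_trans Ab => y [].
- by apply: subset_trans Ab => y [].
Qed.

Lemma nu_sum_le (I : eqType) (F : I -> set X) (s : seq I) A x r :
  uniq s -> (forall i, i \in s -> mu.-cara.-measurable (F i)) ->
  {in s &, forall i j, i != j -> F i `&` F j = set0} ->
  (forall i, i \in s -> F i `<=` A) -> A `<=` ball x r ->
  \sum_(i <- s) nu (F i) <= nu A.
Proof.
elim: s A => [|i s IH] A; first by rewrite big_nil nu_ge0.
move=> /= /andP[is_ us] mF dF FA Ab; rewrite big_cons.
have mi : mu.-cara.-measurable (F i) by apply: mF; rewrite mem_head.
rewrite (nu_split mi Ab); apply: lerD.
  have -> // : A `&` F i = F i.
  by apply/setIidPr; apply: FA; rewrite mem_head.
apply: IH => //.
- by move=> j js; apply: mF; rewrite inE js orbT.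
- by move=> j k js ks; apply: dF; rewrite inE ?js ?ks orbT.
- move=> j js y Fjy; split; first by apply: (FA j) => //; rewrite inE js orbT.
  move=> Fiy; have : (F j `&` F i) y by [].
  rewrite dF ?inE ?js ?eqxx ?orbT//; apply: contraNneq is_ => <-//.
- by apply: subset_trans Ab => y [].
Qed.

Lemma nu_cover_le (I : eqType) (F : I -> set X) (s : seq I) A x r :
  (forall i, i \in s -> F i `<=` ball x r) ->
  (forall y, A y -> exists2 i, i \in s & F i y) ->
  nu A <= \sum_(i <- s) nu (F i).
Proof.
elim: s A => [|i s IH] A Fb cA.
  have -> : A = set0 by rewrite -subset0 => y /cA[].
  by rewrite nu0 big_nil.
have Ab : A `<=` ball x r by move=> y /cA[j js]; exact: Fb.
rewrite big_cons; pose A' := A `&` ~` F i.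
have AA : A `<=` F i `|` A' by move=> y Ay; have [?|?] := pselect (F i y); [left|right].
have Fi : F i `<=` ball x r by apply: Fb; rewrite mem_head.
have FA' : F i `|` A' `<=` ball x r by move=> y [/Fi//|[/Ab]].
apply: le_trans (nu_le AA FA') _; apply: le_trans (nuU FA') _.
rewrite lerD2l; apply: IH => [j js|y [/cA[j]]].
  by apply: Fb; rewrite inE js orbT.
by rewrite inE => /predU1P[->//|js Fj _]; exists j.
Qed.

Definition disjoint_balls (rad : X -> R) (s : seq X) :=
  {in s &, forall y z, y != z -> ball y (rad y) `&` ball z (rad z) = set0}.

(** Greedy selection, by induction on a bound [n] for the size of disjoint subfamilies. Choose a
    ball of more than half the supremal radius and discard the balls meeting it; for the rest the
    bound drops by one. A discarded centre is at distance less than three times the chosen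
    radius. *)
Let vitali_bounded (rad : X -> R) (m M : R) n : 0 < m -> forall D : set X,
  (forall y, D y -> m <= rad y <= M) ->
  (forall s : seq X, uniq s -> (forall y, y \in s -> D y) -> disjoint_balls rad s ->
     (size s <= n)%N) ->
  exists s : seq X, [/\ uniq s, forall y, y \in s -> D y, disjoint_balls rad s &
     forall y, D y -> exists2 z, z \in s & ball z (4 * rad z) y].
Proof.
move=> m0; elim: n => [|n IH] D radD cap.
  exists [::]; split => // y Dy.
  suff : (size [:: y] <= 0)%N by [].
  apply: cap => // [z|z w]; first by rewrite inE => /eqP ->.
  by rewrite !inE => /eqP -> /eqP ->; rewrite eqxx.
have [[x0 Dx0]|D0] := pselect (exists x, D x); last first.
  exists [::]; split => // y Dy; exfalso; apply: D0; by exists y.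
have radM : has_ubound (rad @` D) by exists M => _ [y /radD/andP[_ h] <-].
have rad0 : rad @` D !=set0 by exists (rad x0), x0.
have sup0 : 0 < sup (rad @` D).
  apply: lt_le_trans m0 _; have /andP[h _] := radD _ Dx0; apply: le_trans h _.
  by apply: ub_le_sup => //; exists x0.
have [_ [x Dx <-] radx] : exists2 v, (rad @` D) v & sup (rad @` D) / 2 < v.
  apply: contrapT => h; have : sup (rad @` D) <= sup (rad @` D) / 2; last by lra.
  apply: ge_sup => // v Dv; rewrite leNgt; apply/negP => hv; apply: h; by exists v.
pose D' := [set y | D y /\ ball y (rad y) `&` ball x (rad x) = set0].
have D'D y : D' y -> D y by case.
have nDx : ~ D' x.
  move=> [_ h]; have : set0 x by rewrite -h; split; apply/ballP; rewrite mdistxx;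
    have /andP[h1 _] := radD _ Dx; lra.
  by [].
have dcons (s : seq X) : (forall y, y \in s -> D' y) -> disjoint_balls rad s ->
    disjoint_balls rad (x :: s).
  move=> sD' ds y z; rewrite !inE => /predU1P[->|ys] /predU1P[->|zs]; rewrite ?eqxx//.
  - by move=> _; rewrite setIC; have [] := sD' _ zs.
  - by move=> _; have [] := sD' _ ys.
  - exact: ds.
have [|s us sD' ds|s [us sD' ds cs]] := IH D'.
- by move=> y [/radD].
- have /= := cap (x :: s); rewrite ltnS; apply.
  + by rewrite us andbT; apply/negP => /sD'.
  + by move=> y; rewrite inE => /predU1P[->//|/sD'[]].
  + exact: dcons.
exists (x :: s); split.
- by rewrite /= us andbT; apply/negP => /sD'.
- by move=> y; rewrite inE => /predU1P[->//|/sD'[]].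
- exact: dcons.
move=> y Dy; have [/cs[z zs yz]|nD'] := pselect (D' y).
  by exists z => //; rewrite inE zs orbT.
exists x; first by rewrite mem_head.
have /set0P[z [/ballP yz /ballP xz]] : ball y (rad y) `&` ball x (rad x) != set0.
  by apply/eqP => h; apply: nD'.
apply/ballP; have := metric_triangle x z y; rewrite (metric_sym z y).
have : rad y <= sup (rad @` D) by apply: ub_le_sup => //; exists y.
have /andP[h1 _] := radD _ Dx; lra.
Qed.

(* The bounds on the radii and on [D] make every disjoint subfamily finite. *)
Lemma vitali_covering (D : set X) (rad : X -> R) (m M : R) x r : 0 < m ->
  (forall y, D y -> m <= rad y <= M) -> D `<=` ball x r ->
  exists s : seq X, [/\ uniq s, forall y, y \in s -> D y, disjoint_balls rad s &
     forall y, D y -> exists2 z, z \in s & ball z (4 * rad z) y].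
Proof.
move=> m0 radD Db; have [r0|r0] := leP r 0.
  exists [::]; split => // y /Db; by rewrite ball_le0.
have [k hk] : exists k : nat, 2 * r <= 2 ^+ k * m.
  exists (Num.truncn (2 * r / m)).+1; rewrite -ler_pdivrMr//.
  apply/ltW/(lt_le_trans (truncnS_gt _)).
  by rewrite -natrX ler_nat ltnW// ltn_expl.
have C20 : 0 < 2 ^+ k :> R by rewrite exprn_gt0.
(* By doubling, every ball of the family has measure at least [e]. Disjoint ones all lie in
   [ball x (r + M)], which bounds their number. *)
pose e := nu (ball x r) / Cmu ^+ k.
have C0 : 0 < Cmu ^+ k by rewrite exprn_gt0// (lt_le_trans ltr01).
have e0 : 0 < e by rewrite divr_gt0// nu_ball_gt0.
apply: (@vitali_bounded rad m M (Num.truncn (nu (ball x (r + M)) / e)) m0 D radD).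
move=> s us sD ds; rewrite -ltnS -(@ltr_nat R); apply: le_lt_trans (truncnS_gt _).
rewrite ler_pdivlMr//.
apply: (@le_trans _ _ (\sum_(y <- s) nu (ball y (rad y)))); last first.
  apply: (@nu_sum_le _ _ _ _ x (r + M)) => //.
  - by move=> y _; exact: ball_cara.
  - move=> y /sD Dy; apply: ball_sub; have /andP[_ h] := radD _ Dy.
    by have /ballP := Db _ Dy; lra.
have {us ds} : forall y, y \in s -> e <= nu (ball y (rad y)).
  move=> y /sD Dy; rewrite ler_pdivrMr// mulrC; apply: nu_ball_le.
  have /andP[h _] := radD _ Dy; apply: le_trans (ler_wpM2l (ltW C20) h).
  have /ballP := Db _ Dy; rewrite metric_sym; lra.
elim: s {sD} => [|y s IH] es; first by rewrite mul0r big_nil.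
rewrite big_cons /= -natr1 mulrDl mul1r addrC; apply: lerD; first by apply: es; rewrite mem_head.
by apply: IH => z zs; apply: es; rewrite inE zs orbT.
Qed.

End doubling_measure.

(** * The Poincare inequality at one scale *)

Section one_scale_estimate.
Context {R : realType} {X : pointedMetricType R}.
Variables (mu : {outer_measure set X -> \bar R}) (Cmu CP tauP : R).
Hypothesis Cmu1 : 1 <= Cmu.
Hypothesis CP1 : 1 <= CP.
Hypothesis tauP1 : 1 <= tauP.
Hypothesis mu_reg : borel_regular mu.
Hypothesis mu_dbl : doubling mu Cmu.
Hypothesis mu_PI : poincare11 mu CP tauP.
Implicit Types (x y z : X) (A B E : set X) (r s : R).

Local Notation nu := (nu mu).
Local Notation muE := (muE Cmu1 mu_dbl).
Local Notation mu_ballE := (mu_ballE Cmu1 mu_dbl).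
Local Notation nu_le := (nu_le Cmu1 mu_dbl).

Lemma continuous_cara_measurable (f : X -> R) : continuous f ->
  measurable_fun setT (EFin \o f : caratheodory_type mu -> \bar R).
Proof.
move=> cf; apply/measurable_EFinP.
apply: (measurability _ (RGenOpens.measurableE R)) => _ [_ [a [b ->]] <-].
rewrite setTI; apply: open_cara => //.
by apply: open_comp => //; exact: interval_open.
Qed.

(** The mean [m] of the tent differs from 0 or from 1 by at least 1/2. On that level set [|u - m|]
    is at least 1/2, so half its measure is controlled by the mean oscillation. *)
Lemma tent_poincare (S : set X) (t rho : R) x : 0 < t -> 0 < rho ->
  Num.min (nu (ball x rho `&` [set y | tent S t y = 1]))
          (nu (ball x rho `&` [set y | tent S t y = 0])) <=
  2 * CP * (rho / t) * nu (ball x (tauP * rho) `&` tent_slope S t).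
Proof.
move=> t0 rho0; set B := ball x rho; set u := tent S t.
set G := tent_slope S t; set tB := ball x (tauP * rho).
have tP0 : 0 < tauP by move: tauP1; lra.
have mB : mu.-cara.-measurable B by exact: ball_cara.
have mu_u : measurable_fun setT (EFin \o u : caratheodory_type mu -> \bar R).
  by apply: continuous_cara_measurable; exact: tent_continuous.
have cu : continuous u by exact: tent_continuous.
have mlev (v : R) : mu.-cara.-measurable [set y | u y = v].
  rewrite -[X in measurable X]setCK; apply: measurableC; apply: open_cara => //.
  have -> : ~` [set y | u y = v] = u @^-1` [set~ v] by [].
  by apply: open_comp => //; rewrite openC; exact: closed_eq.
have u0 y : (0 <= (u y)%:E)%E by rewrite lee_fin tent_ge0.
have intu : ((0 <= \int[cara_measure mu]_(y in B) (u y)%:E) /\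
    (\int[cara_measure mu]_(y in B) (u y)%:E <= (nu B)%:E))%E.
  split; first by apply: integral_ge0.
  have -> : (nu B)%:E = (\int[cara_measure mu]_(y in B) cst 1%:E y)%E.
    by rewrite integral_cst// mul1e -mu_ballE.
  apply: ge0_le_integral_nomeas => // y _; by rewrite lee_fin tent_le1.
have B0 : 0 < nu B by exact: (nu_ball_gt0 Cmu1).
have tB0 : 0 < nu tB by apply: (nu_ball_gt0 Cmu1) => //; rewrite mulr_gt0.
have L1u : L1_loc mu (EFin \o u).
  split => // y; exists 1 => //; apply/integrableP; split.
    exact: measurable_funTS.
  apply: (@le_lt_trans _ _ (\int[cara_measure mu]_(z in ball y 1) cst 1%:E z)%E).
    apply: ge0_le_integral_nomeas => // z _.
    by rewrite gee0_abs//= lee_fin tent_le1.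
  rewrite integral_cst; last exact: ball_cara.
  by rewrite mul1e; exact: (mu_ball_lty Cmu1).
have := mu_PI x rho0 L1u (tent_upper_gradient S t0).
rewrite -/u -/B -/tB -/G.
have -> : mean mu tB (fun y => (t^-1 * \1_G y)%:E) = (t^-1 * (nu (tB `&` G) / nu tB))%:E.
  rewrite /mean mu_ballE inver gt_eqF//.
  have -> : (\int[cara_measure mu]_(y in tB) (t^-1 * \1_G y)%:E)%E = (t^-1 * nu (tB `&` G))%:E.
    rewrite integral_scale_indic; last 3 first.
    - by apply: open_cara => //; exact: open_tent_slope.
    - exact: ball_cara.
    - by rewrite invr_ge0 ltW.
    by rewrite EFinM setIC -(@muE _ x (tauP * rho))// => y [].
  by rewrite -EFinM -mulrA.
have [m [mE m01]] : exists m : R, mean mu B (EFin \o u) = m%:E /\ 0 <= m <= 1.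
  case: intu => h0 h1; rewrite /mean mu_ballE inver gt_eqF//=.
  have hf : (\int[cara_measure mu]_(y in B) (u y)%:E)%E \is a fin_num.
    by rewrite ge0_fin_numE//; apply: le_lt_trans h1 _; rewrite ltry.
  exists (fine (\int[cara_measure mu]_(y in B) (u y)%:E)%E / nu B).
  rewrite EFinM fineK//; split => //.
  rewrite divr_ge0 ?fine_ge0 ?nu_ge0//= ler_pdivrMr// mul1r.
  by rewrite -lee_fin fineK.
rewrite mE => PI.
have low (v : R) : (forall y, B y -> u y = v -> 1 / 2 <= `|u y - m|) ->
    nu (B `&` [set y | u y = v]) <=
    2 * CP * (rho / t) * nu (tB `&` G).
  move=> hv.
  have h1 : ((1 / 2 * nu (B `&` [set y | u y = v]) / nu B)%:E <=
      mean mu B (fun y => `|(EFin \o u) y - m%:E|%E))%E.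
    rewrite /mean mu_ballE inver gt_eqF// EFinM lee_wpmul2r//.
      by rewrite lee_fin invr_ge0 ltW.
    rewrite EFinM -(@muE _ x rho); last by move=> y [].
    apply: ge0_integral_ge_cst => //.
    - by apply: measurableI => //; exact: mlev.
    - by move=> y [By uy]; rewrite lee_fin; exact: hv.
  have := le_trans h1 PI; rewrite -EFinM lee_fin => {}h1.
  have nB : nu B <= nu tB.
    apply: (@nu_le _ _ x (tauP * rho)) => //; apply: ball_sub.
    by rewrite mdistxx add0r ler_pMl.
  (* Dividing by the smaller [nu B] instead of [nu tB] lets [nu B] cancel on both sides. *)
  have h2 : nu (tB `&` G) / nu tB <= nu (tB `&` G) / nu B.
    by apply: ler_wpM2l; rewrite ?nu_ge0// lef_pV2// posrE.
  have h3 : CP * rho * (t^-1 * (nu (tB `&` G) / nu tB)) <=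
      CP * rho * (t^-1 * (nu (tB `&` G) / nu B)).
    apply: ler_wpM2l; first by rewrite mulr_ge0 ?ltW//; move: CP1; lra.
    by apply: ler_wpM2l => //; rewrite invr_ge0 ltW.
  have := le_trans h1 h3; rewrite !mulrA ler_pM2r ?invr_gt0//; lra.
rewrite ge_min; have [m12|m12] := leP m (1 / 2).
  apply/orP; left; apply: low => y _ ->; rewrite ger0_norm; lra.
apply/orP; right; apply: low => y _ ->; rewrite ltr0_norm; lra.
Qed.

End one_scale_estimate.

(** * Sets of low density and of two-sided density *)

Section density_sets.
Context {R : realType} {X : pointedMetricType R}.
Variables (mu : {outer_measure set X -> \bar R}) (Cmu : R).
Hypothesis Cmu1 : 1 <= Cmu.
Hypothesis mu_reg : borel_regular mu.
Hypothesis mu_dbl : doubling mu Cmu.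
Implicit Types (x y z : X) (A B E : set X) (r s : R).

Local Notation nu := (nu mu).
Local Notation nu_le := (nu_le Cmu1 mu_dbl).
Local Notation nu_le_ball := (nu_le_ball Cmu1 mu_dbl).
Local Notation nu_ball_le := (nu_ball_le Cmu1 mu_dbl).

Let C0 k : 0 < Cmu ^+ k.
Proof. by rewrite exprn_gt0// (lt_le_trans ltr01). Qed.

(** Vitali at the single radius [t]: the balls of radius [4 * t] cover the set and carry little of
    [A], while those of radius [t] are disjoint in [ball x0 (2 * rho)]. The two changes of radius
    cost [Cmu ^+ 2] and [Cmu]. *)
Lemma low_density_le A x0 (rho t delta : R) : 0 < t -> t <= rho -> 0 <= delta ->
  nu [set x | [/\ A x, ball x0 rho x &
    nu (A `&` ball x (4 * t)) < delta * nu (ball x (4 * t))]] <=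
  delta * Cmu ^+ 3 * nu (ball x0 rho).
Proof.
move=> t0 trho d0; set D := [set x | _].
have Db : D `<=` ball x0 rho by move=> x [].
have [|s [us sD ds cs]] := vitali_covering Cmu1 mu_reg mu_dbl (rad := fun _ => t) (M := t) t0 _ Db.
  by move=> y _; rewrite lexx.
have sb y : y \in s -> ball y (4 * t) `<=` ball x0 (5 * rho).
  by move=> /sD/Db/ballP h; apply: ball_sub; lra.
apply: (@le_trans _ _ (\sum_(y <- s) nu (A `&` ball y (4 * t)))).
  apply: (@nu_cover_le _ _ _ _ Cmu1 mu_dbl _ _ _ _ x0 (5 * rho)).
    by move=> y /sb ys z [_ /ys].
  by move=> y Dy; have [z zs yz] := cs _ Dy; exists z => //; split => //; case: Dy.
apply: (@le_trans _ _ (\sum_(y <- s) delta * Cmu ^+ 2 * nu (ball y t))).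
  rewrite big_seq [leRHS]big_seq; apply: ler_sum => y /sD[_ _ /ltW h].
  apply: le_trans h _; rewrite -mulrA ler_wpM2l//; apply: nu_ball_le.
  rewrite mdistxx; lra.
rewrite -mulr_sumr (exprSr _ 2) mulrA -[leRHS]mulrA.
apply: ler_wpM2l; first by rewrite mulr_ge0// ltW.
apply: (@le_trans _ _ (nu (ball x0 (2 * rho)))).
  apply: (@nu_sum_le _ _ _ _ Cmu1 mu_dbl _ _ _ _ x0 (2 * rho)) => //.
  - by move=> y _; exact: ball_cara.
  - by move=> y /sD/Db/ballP h; apply: ball_sub; lra.
exact: nu_double.
Qed.

(** Take for [U] the union of the balls of radius [r] about [H]. A ball of radius [2 * r] about a
    point of [U] contains one of them, hence enough of the complement; a Vitali family of them gives
    the mass of [E]. The open set [U] replaces [H] as a domain of integration. *)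
Lemma two_sided_density_nbhd E (H : set X) x0 (rho r delta : R) :
  mu.-cara.-measurable E -> 0 < r -> 0 < delta -> H `<=` ball x0 rho ->
  (forall h, H h -> delta * nu (ball h r) <= nu (ball h r `&` E)) ->
  (forall h, H h -> delta * nu (ball h r) <= nu (ball h r `\` E)) ->
  exists U : set X, [/\ open U, U `<=` ball x0 (rho + r),
    nu H <= Cmu ^+ 2 / delta * nu (E `&` U) &
    forall x, U x -> nu (ball x (2 * r)) <= Cmu ^+ 2 / delta * nu (ball x (2 * r) `\` E)].
Proof.
move=> mE r0 d0 Hb HE HE'.
pose U : set X := \bigcup_(h in H) ball h r.
have Ub : U `<=` ball x0 (rho + r).
  by move=> y [h /Hb/ballP h1]; apply: ball_sub; lra.
have oU : open U by apply: bigcup_open => h _; exact: open_metric_ball.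
exists U; split => //; last first.
  move=> x [h Hh /ballP hx].
  apply: (@le_trans _ _ (Cmu ^+ 2 * nu (ball h r))).
    by apply: nu_ball_le; lra.
  rewrite -mulrA ler_wpM2l ?(ltW (C0 _))// mulrC ler_pdivlMr// mulrC.
  apply: le_trans (HE' _ Hh) _; apply: (@nu_le _ _ x (2 * r)); last by move=> y [].
  apply: setSD; apply: ball_sub; rewrite metric_sym; lra.
have [|s [us sH ds cs]] := vitali_covering Cmu1 mu_reg mu_dbl (rad := fun _ => r) (M := r) r0 _ Hb.
  by move=> y _; rewrite lexx.
apply: (@le_trans _ _ (\sum_(y <- s) nu (ball y (4 * r)))).
  apply: (@nu_cover_le _ _ _ _ Cmu1 mu_dbl _ _ _ _ x0 (rho + 4 * r)) => //.
  by move=> y /sH/Hb/ballP h1; apply: ball_sub; lra.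
apply: (@le_trans _ _ (\sum_(y <- s) Cmu ^+ 2 / delta * nu (ball y r `&` E))).
  rewrite big_seq [leRHS]big_seq; apply: ler_sum => y /sH /HE h.
  apply: (@le_trans _ _ (Cmu ^+ 2 * nu (ball y r))).
    by apply: nu_ball_le; rewrite mdistxx; lra.
  by rewrite -mulrA ler_wpM2l ?(ltW (C0 _))// mulrC ler_pdivlMr// mulrC.
rewrite -mulr_sumr ler_wpM2l ?divr_ge0 ?(ltW (C0 _)) ?(ltW d0)//.
apply: (@nu_sum_le _ _ _ _ Cmu1 mu_dbl _ _ _ _ x0 (rho + r)) => //.
- by move=> y _; apply: measurableI => //; exact: ball_cara.
- move=> y z ys zs yz; rewrite -subset0 => w [[h1 _] [h2 _]].
  by rewrite -(ds y z ys zs yz).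
- by move=> y ys z [h1 h2]; split => //; exists y => //; exact: sH.
- by move=> y [_ /Ub].
Qed.

End density_sets.

(** * From density at one scale to density at a smaller scale *)

Section one_scale.
Context {R : realType} {X : pointedMetricType R}.
Variables (mu : {outer_measure set X -> \bar R}) (Cmu CP tauP : R).
Hypothesis Cmu1 : 1 <= Cmu.
Hypothesis CP1 : 1 <= CP.
Hypothesis tauP1 : 1 <= tauP.
Hypothesis mu_reg : borel_regular mu.
Hypothesis mu_dbl : doubling mu Cmu.
Hypothesis mu_PI : poincare11 mu CP tauP.
Implicit Types (x y z : X) (A B E : set X) (r s : R).

Local Notation nu := (nu mu).
Local Notation nu_le := (nu_le Cmu1 mu_dbl).
Local Notation nu_ball_le := (nu_ball_le Cmu1 mu_dbl).

Let C0 k : 0 < Cmu ^+ k.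
Proof. by rewrite exprn_gt0// (lt_le_trans ltr01). Qed.

Lemma one_scale E x0 (rho t c : R) : mu.-cara.-measurable E ->
  0 < t -> t <= rho -> 0 < c -> c <= 1 ->
  c * nu (ball x0 rho) <= nu (ball x0 rho `&` E) ->
  c * nu (ball x0 rho) <= nu (ball x0 rho `\` E) ->
  let K := 2 * Cmu ^+ 5 / c in
  exists U : set X, [/\ open U, U `<=` ball x0 ((tauP + 4) * rho),
    nu (ball x0 rho) <= 2 / c * (1 + 2 * CP) * K * (rho / t) * nu (E `&` U) &
    forall x, U x -> nu (ball x (8 * t)) <= K * nu (ball x (8 * t) `\` E)].
Proof.
move=> mE t0 trho c0 c1 cE cE' K.
have rho0 : 0 < rho := lt_le_trans t0 trho.
set B := ball x0 rho in cE cE' *.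
(* Chosen so that the low-density points counted in [smle] use up only half of the density [c]. *)
pose delta := c / (2 * Cmu ^+ 3).
have C30 := C0 3.
have d0 : 0 < delta by rewrite divr_gt0// mulr_gt0.
have dC : delta * Cmu ^+ 3 = c / 2.
  by rewrite /delta; field; rewrite gt_eqF// (lt_le_trans ltr01).
have dC2 : Cmu ^+ 2 / delta = K.
  by rewrite /delta /K; field; rewrite !gt_eqF// (lt_le_trans ltr01).
pose S : set X := [set y | nu (ball y t) < 2 * nu (ball y t `&` E)].
have nS y : ~ S y -> nu (ball y t) <= 2 * nu (ball y t `\` E).
  move=> /negP; rewrite -leNgt.
  by have := @nu_split _ _ mu Cmu Cmu1 mu_dbl (ball y t) E y t mE (@subset_refl _ _); lra.
pose H : set X := [set h | [/\ ball x0 (tauP * rho) h,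
  delta * nu (ball h (4 * t)) <= nu (ball h (4 * t) `&` E) &
  delta * nu (ball h (4 * t)) <= nu (ball h (4 * t) `\` E)]].
(* A share of at least half at scale [t] near [x] becomes density [delta] around [x]:
   [ball x (4 * t)] contains [ball y t] and has at most [Cmu ^+ 3] times its measure. *)
have dens x y (F : set X) : mdist x y <= 2 * t ->
    nu (ball y t) <= 2 * nu (ball y t `&` F) ->
    delta * nu (ball x (4 * t)) <= nu (ball x (4 * t) `&` F).
  move=> xy hF.
  apply: (@le_trans _ _ (nu (ball y t `&` F))); last first.
    apply: (@nu_le _ _ x (4 * t)); last by move=> z [].
    by apply: setSI; apply: ball_sub; lra.
  apply: (@le_trans _ _ (delta * (Cmu ^+ 3 * nu (ball y t)))).
    rewrite ler_wpM2l ?(ltW d0)//; apply: nu_ball_le; rewrite metric_sym; lra.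
  rewrite mulrA dC; apply: (@le_trans _ _ (1 / 2 * nu (ball y t))); last by lra.
  by rewrite ler_wpM2r ?nu_ge0//; lra.
have GH : ball x0 (tauP * rho) `&` tent_slope S t `<=` H.
  move=> x [xb [[s Ss xs] [y nSy xy]]]; split => //.
    by apply: (@dens x s E); [lra|exact: ltW].
  by rewrite setDE; apply: (@dens x y); [lra|rewrite -setDE; exact: nS].
have rtau : rho <= tauP * rho by rewrite ler_pMl.
have BtB : B `<=` ball x0 (tauP * rho) by apply: ball_sub; rewrite mdistxx add0r.
have Hb : H `<=` ball x0 (tauP * rho) by move=> x [].
pose sm (A : set X) := [set x | [/\ A x, B x &
    nu (A `&` ball x (4 * t)) < delta * nu (ball x (4 * t))]].
have smle A : nu (sm A) <= c / 2 * nu B.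
  by rewrite -dC; apply: low_density_le => //; exact: ltW.
have three (A F : set X) : B `&` A `<=` (B `&` F) `|` (sm A `|` H) ->
    nu (B `&` A) <= nu (B `&` F) + (c / 2 * nu B + nu H).
  move=> sub.
  have b3 : (B `&` F) `|` (sm A `|` H) `<=` ball x0 (tauP * rho).
    by move=> x [[/BtB//]|[[_ /BtB//]|/Hb]].
  apply: le_trans (nu_le sub b3) _; apply: le_trans (nuU Cmu1 mu_dbl b3) _.
  rewrite lerD2l; apply: le_trans (nuU Cmu1 mu_dbl _) _.
    by move=> x hx; apply: b3; right; exact: hx.
  by rewrite lerD2r.
(* A point of [E] in [B] is in [S], where the tent is 1, or sees little of [E] at scale [4 * t], or
   belongs to [H]. *)
have one : nu (B `&` E) <= nu (B `&` [set y | tent S t y = 1]) + (c / 2 * nu B + nu H).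
  apply: three => x [Bx Ex].
  have [Sx|nSx] := pselect (S x); first by left; split => //; exact: tent_eq1.
  right; have [h|h] := ltP (nu (E `&` ball x (4 * t))) (delta * nu (ball x (4 * t))).
    by left; split.
  right; split; [exact: BtB|by rewrite setIC|].
  rewrite setDE; apply: (@dens x x); first by rewrite mdistxx; lra.
  by rewrite -setDE; exact: nS.
(* A point off [E] is at distance at least [t] from [S], where the tent is 0, or sees little of the
   complement, or belongs to [H]. *)
have zero : nu (B `\` E) <= nu (B `&` [set y | tent S t y = 0]) + (c / 2 * nu B + nu H).
  rewrite setDE; apply: three => x [Bx Ex].
  have [[s Ss xs]|nSx] := pselect (exists2 s, S s & mdist x s < t); last first.
    left; split => //; apply: tent_eq0 => // y Sy; rewrite leNgt; apply/negP => xy.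
    by apply: nSx; exists y.
  right; have [h|h] := ltP (nu (~` E `&` ball x (4 * t))) (delta * nu (ball x (4 * t))).
    by left; split.
  right; split; [exact: BtB| |by rewrite setDE setIC].
  by apply: (@dens x s E); [lra|exact: ltW].
have PI := tent_poincare Cmu1 CP1 tauP1 mu_reg mu_dbl mu_PI S x0 t0 rho0.
have GHn : nu (ball x0 (tauP * rho) `&` tent_slope S t) <= nu H by exact: nu_le Hb.
have rt1 : 1 <= rho / t by rewrite ler_pdivlMr// mul1r.
have CP0 : 1 <= CP by [].
have PI2 : Num.min (nu (B `&` [set y | tent S t y = 1]))
    (nu (B `&` [set y | tent S t y = 0])) <= 2 * CP * (rho / t) * nu H.
  apply: le_trans PI _; apply: ler_wpM2l => //.
  by rewrite mulr_ge0//; lra.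
have H0 := nu_ge0 mu H.
(* Whichever level set is smaller, the remainder [c / 2 * nu B] is absorbed on the left, and
   [1 <= rho / t] merges the multiples of [nu H]. *)
have BH : nu B <= 2 / c * (1 + 2 * CP) * (rho / t) * nu H.
  have : c / 2 * nu B <= (1 + 2 * CP) * (rho / t) * nu H.
    have h2 : nu H <= (rho / t) * nu H by rewrite ler_peMl.
    by move: PI2; rewrite ge_min => /orP[]; lra.
  move=> h; have -> : 2 / c * (1 + 2 * CP) * (rho / t) * nu H =
      2 / c * ((1 + 2 * CP) * (rho / t) * nu H) by rewrite !mulrA.
  rewrite mulrAC ler_pdivlMr// mulrC; lra.
have [|||U [oU Ub HU Udens]] := @two_sided_density_nbhd _ _ mu Cmu Cmu1
  mu_reg mu_dbl E H x0 _ (4 * t) delta mE _ d0 Hb.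
- by lra.
- by move=> h [].
- by move=> h [].
exists U; split => //.
- by apply: subset_trans Ub _; apply: ball_sub; rewrite mdistxx mulrDl; lra.
- apply: le_trans BH _; rewrite dC2 in HU.
  have -> : 2 / c * (1 + 2 * CP) * K * (rho / t) * nu (E `&` U) =
      2 / c * (1 + 2 * CP) * (rho / t) * (K * nu (E `&` U)) by ring.
  apply: ler_wpM2l => //; rewrite !mulr_ge0// ?invr_ge0; lra.
- by move=> x /Udens; rewrite dC2 mulrA; have -> : 2 * 4 = 8 :> R by ring.
Qed.

End one_scale.

(** * Lower bounds for the fractional perimeter *)

Section dyadic_sums.
Context {R : realType}.
Implicit Types (theta z : R).

Lemma powR2_exp theta k : (2 `^ theta) ^+ k = (2 ^+ k) `^ theta :> R.
Proof. by rewrite -powR_mulrn ?powR_ge0// powRAC powR_mulrn. Qed.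

(** For [theta] at least 1/2 the ratio is at least 4/3, so the geometric sum is comparable to its
    last term. Below 1/2 at most one term is allowed, which keeps the constant from growing as
    [theta] tends to 0. *)
Lemma dyadic_sum_le theta z K : 0 < theta -> 0 < z -> 1 / 2 <= theta \/ (K <= 1)%N ->
  \sum_(k < K | 2 ^+ k < z) (2 `^ theta) ^+ k <= 4 * z `^ theta.
Proof.
move=> theta0 z0 thK; pose a : R := 2 `^ theta.
have a0 : 0 < a by exact: powR_gt0.
have ak_le k : 2 ^+ k < z -> a ^+ k <= z `^ theta.
  move=> h; rewrite powR2_exp; apply: ge0_ler_powR; rewrite ?nnegrE ?exprn_ge0 ?(ltW h) ?(ltW z0)//.
  exact: ltW.
case: thK => [th12|K1]; last first.
  case: K K1 => [_|[_|//]]; first by rewrite big_ord0 mulr_ge0// powR_ge0.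
  rewrite big_mkcond big_ord_recr big_ord0 /= add0r.
  case: ifPn => [/ak_le h|_]; last by rewrite mulr_ge0// powR_ge0.
  by have := powR_ge0 z theta; move: h; rewrite -/a; lra.
have a43 : 4 / 3 <= a.
  apply: (@le_trans _ _ (2 `^ (2^-1))); last by rewrite ler_powR//; lra.
  rewrite powR12_sqrt//; have -> : 4 / 3 = Num.sqrt ((4 / 3) ^+ 2) :> R.
    by rewrite sqrtr_sqr ger0_norm//; lra.
  by apply: ler_wsqrtr; lra.
have sum_le k : \sum_(i < k) a ^+ i <= 3 * a ^+ k.
  elim: k => [|k IH]; first by rewrite big_ord0 expr0; lra.
  rewrite big_ord_recr/= exprS; have : 0 < a ^+ k by rewrite exprn_gt0.
  by nra.
elim: K => [|K IH]; first by rewrite big_ord0 mulr_ge0// powR_ge0.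
rewrite big_mkcond big_ord_recr/=; case: ifPn => [hK|_]; last first.
  by rewrite addr0 -big_mkcond.
apply: (@le_trans _ _ (\sum_(i < K) a ^+ i + a ^+ K)).
  rewrite lerD2r; apply: ler_sum => i _; case: ifPn => // _.
  by rewrite exprn_ge0// ltW.
by have := sum_le K; have := ak_le K hK; lra.
Qed.

(** With [s = 1 - theta] the ratio is [b = 2 ^ (- s)]. More than [1 / s] terms bring [b ^+ K] below
    1/2, and [1 - b <= s], so the sum is at least [1 / (2 * s)]. *)
Lemma dyadic_sum_ge theta : 0 < theta < 1 ->
  exists2 K, 1 / 2 <= theta \/ (K <= 1)%N &
    1 <= 2 * (1 - theta) * \sum_(k < K) (2 `^ theta / 2) ^+ k.
Proof.
move=> /andP[th0 th1]; have [th12|th12] := leP (1 / 2) theta; last first.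
  by exists 1%N; [right|rewrite big_ord_recr big_ord0 /= expr0; lra].
pose s := 1 - theta; have s0 : 0 < s by rewrite subr_gt0.
pose b : R := 2 `^ theta / 2.
have bE : b = 2 `^ (- s).
  by rewrite /b /s opprB powRB ?powRr1// pnatr_eq0 implybT.
exists (Num.truncn s^-1).+1; first by left.
set K := (Num.truncn s^-1).+1.
have sK : 1 <= s * K%:R.
  by rewrite mulrC -ler_pdivrMr// mul1r ltW// truncnS_gt.
have bK : b ^+ K <= 1 / 2.
  rewrite bE -powR_mulrn ?powR_ge0// -powRrM mulNr.
  apply: (@le_trans _ _ (2 `^ (- 1))); first by rewrite ler_powR//; lra.
  by rewrite powR_inv1// mul1r.
have b1 : 1 - b <= s.
  have : 1 + (- s * ln 2) <= b by rewrite bE /powR gt_eqF// expR_ge1Dx.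
  have : ln 2 <= 1 :> R.
    rewrite -[leRHS]expRK ler_ln ?posrE ?expR_gt0//.
    by have := @expR_ge1Dx R 1; lra.
  by move=> /(ler_wpM2l (ltW s0)); lra.
have := subrX1 b K; rewrite -/s => h.
have S0 : 0 <= \sum_(k < K) b ^+ k.
  by apply: sumr_ge0 => k _; rewrite exprn_ge0// divr_ge0// powR_ge0.
have := ler_wpM2r S0 b1; rewrite -/b; lra.
Qed.

End dyadic_sums.

(** * The kernel and its inner integral *)

Section kernel.
Context {R : realType} {X : pointedMetricType R}.
Variables (mu : {outer_measure set X -> \bar R}) (Cmu : R).
Hypothesis Cmu1 : 1 <= Cmu.
Hypothesis mu_reg : borel_regular mu.
Hypothesis mu_dbl : doubling mu Cmu.
Implicit Types (x y z : X) (A B E Om : set X) (theta s L : R) (K : nat).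

Local Notation nu := (nu mu).
Local Notation muE := (muE Cmu1 mu_dbl).
Local Notation mu_ballE := (mu_ballE Cmu1 mu_dbl).
Local Notation nu_le := (nu_le Cmu1 mu_dbl).
Local Notation nu_ball_le := (nu_ball_le Cmu1 mu_dbl).

Definition frac_kernel theta x y : \bar R :=
  (2%:E / ((mdist x y `^ theta)%:E *
    (mu (ball x (mdist x y)) + mu (ball y (mdist x y)))))%E.

Definition frac_potential theta E Om x : \bar R :=
  (\int[cara_measure mu]_(y in Om `\` E) frac_kernel theta x y)%E.

Lemma fractional_perimeterE theta E Om : fractional_perimeter mu theta E Om =
  (\int[cara_measure mu]_(x in Om `&` E) frac_potential theta E Om x)%E.
Proof. by []. Qed.

Lemma frac_kernel_ge0 theta x y : (0 <= frac_kernel theta x y)%E.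
Proof.
rewrite /frac_kernel mule_ge0// inve_ge0 mule_ge0// ?lee_fin ?powR_ge0//.
by rewrite adde_ge0// outer_measure_ge0.
Qed.

Lemma frac_potential_ge0 theta E Om x : (0 <= frac_potential theta E Om x)%E.
Proof. by apply: integral_ge0 => y _; exact: frac_kernel_ge0. Qed.

(** By doubling, the two measures in the denominator add up to at most [2 * Cmu] times the one about
    [x], and the 2 cancels the numerator. *)
Lemma frac_kernel_ge theta x y : x <> y ->
  ((Cmu * mdist x y `^ theta * nu (ball x (mdist x y)))^-1%:E <= frac_kernel theta x y)%E.
Proof.
move=> xy; have d0 : 0 < mdist x y by rewrite mdist_gt0; apply/eqP.
rewrite /frac_kernel; set d := mdist x y in d0 *; set p := d `^ theta.
have p0 : 0 < p by exact: powR_gt0.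
have V0 : 0 < nu (ball x d) by exact: (nu_ball_gt0 Cmu1).
have W0 := nu_ge0 mu (ball y d).
have C0 : 0 < Cmu by rewrite (lt_le_trans ltr01).
have WV : nu (ball y d) <= Cmu ^+ 1 * nu (ball x d) by apply: nu_ball_le; rewrite -/d; lra.
rewrite expr1 in WV.
have q0 : 0 < p * (nu (ball x d) + nu (ball y d)) by rewrite mulr_gt0//; lra.
rewrite !mu_ballE -EFinD -EFinM inver gt_eqF// -EFinM lee_fin.
rewrite ler_pdivlMr// mulrC ler_pdivrMr ?mulr_gt0//.
have h : nu (ball x d) <= Cmu * nu (ball x d) by rewrite ler_peMl// ltW.
have := ler_wpM2l (ltW p0) h; have := ler_wpM2l (ltW p0) WV; lra.
Qed.

(** With [d] the distance of the points, only scales with [2 ^+ k < s / d] contribute. Their balls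
    contain [ball x d], and [dyadic_sum_le] at [s / d] bounds the weights. One pointwise bound thus
    serves all scales at once. *)
Lemma frac_kernel_dyadic theta s K x y : 0 < theta -> 0 < s -> x <> y ->
  1 / 2 <= theta \/ (K <= 1)%N ->
  (((4 * Cmu * s `^ theta)^-1 * \sum_(k < K) (2 `^ theta) ^+ k /
    nu (ball x (s / 2 ^+ k)) * \1_(ball x (s / 2 ^+ k)) y)%:E <= frac_kernel theta x y)%E.
Proof.
move=> th0 s0 xy thK; apply: le_trans (frac_kernel_ge theta xy); rewrite lee_fin.
have d0 : 0 < mdist x y by rewrite mdist_gt0; apply/eqP.
set d := mdist x y in d0 *.
have V0 : 0 < nu (ball x d) by exact: (nu_ball_gt0 Cmu1).
have C0 : 0 < Cmu by rewrite (lt_le_trans ltr01).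
have z0 : 0 < s / d by rewrite divr_gt0.
have p0 : 0 < d `^ theta by exact: powR_gt0.
have sp0 : 0 < s `^ theta by exact: powR_gt0.
rewrite mulrC ler_pdivrMr ?mulr_gt0//.
apply: (@le_trans _ _ ((\sum_(k < K | 2 ^+ k < s / d) (2 `^ theta) ^+ k) / nu (ball x d))).
  rewrite [X in X / _]big_mkcond mulr_suml; apply: ler_sum => k _.
  have k0 : 0 < 2 ^+ k :> R by rewrite exprn_gt0.
  have a0 : 0 <= (2 `^ theta) ^+ k :> R by rewrite exprn_ge0// powR_ge0.
  rewrite indicE; case: ifPn => [h|h].
    apply: (@le_trans _ _ ((2 `^ theta) ^+ k / nu (ball x (s / 2 ^+ k)))).
      rewrite ler_piMr ?divr_ge0 ?nu_ge0//.
      by case: (_ \in _).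
    have dk : d < s / 2 ^+ k by move: h; rewrite !ltr_pdivlMr// mulrC.
    rewrite ler_wpM2l// lef_pV2 ?posrE//; last first.
      by apply: (nu_ball_gt0 Cmu1) => //; exact: lt_trans dk.
    by apply: (nu_le_ball Cmu1) => //; apply: ball_sub; rewrite mdistxx add0r ltW.
  rewrite memNset ?mulr0 ?mul0r// => /ballP; rewrite -/d => dk.
  by move: h; rewrite ltr_pdivlMr// mulrC -ltr_pdivlMr// dk.
have h := dyadic_sum_le th0 z0 thK.
have := ler_wpM2r (ltW (_ : 0 < (nu (ball x d))^-1)) h; rewrite invr_gt0 => /(_ V0) {}h.
apply: le_trans h _; rewrite powRM ?invr_ge0 ?(ltW s0) ?(ltW d0)//.
have -> : d^-1 `^ theta = (d `^ theta)^-1.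
  by rewrite -[d^-1]powR_inv1 ?(ltW d0)// powRAC powR_inv1 ?powR_ge0.
rewrite le_eqVlt; apply/orP; left; apply/eqP; field.
by rewrite !gt_eqF.
Qed.

(** [J] selects scales at which the complement of [E] is dense around [x], and may vary with [x]. In
    the term-by-term integral, density [1 / L] cancels the measure of the ball. *)
Lemma frac_potential_ge theta s L K (J : pred nat) E Om x :
  0 < theta -> 0 < s -> 0 < L -> 1 / 2 <= theta \/ (K <= 1)%N ->
  mu.-cara.-measurable E -> mu.-cara.-measurable Om -> E x ->
  (forall k, (k < K)%N -> J k -> ball x (s / 2 ^+ k) `<=` Om /\
    nu (ball x (s / 2 ^+ k)) <= L * nu (ball x (s / 2 ^+ k) `\` E)) ->
  (((4 * Cmu * s `^ theta * L)^-1 * \sum_(k < K | J k) (2 `^ theta) ^+ k)%:E <=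
   frac_potential theta E Om x)%E.
Proof.
move=> th0 s0 L0 thK mE mO Ex HJ.
have C0 : 0 < Cmu by rewrite (lt_le_trans ltr01).
have sp0 : 0 < s `^ theta by exact: powR_gt0.
pose c := (4 * Cmu * s `^ theta)^-1.
have c0 : 0 < c by rewrite invr_gt0 !mulr_gt0.
have k0 k : 0 < 2 ^+ k :> R by rewrite exprn_gt0.
have a0 k : 0 <= (2 `^ theta) ^+ k :> R by rewrite exprn_ge0// powR_ge0.
have V0 k : 0 < nu (ball x (s / 2 ^+ k)) by apply: (nu_ball_gt0 Cmu1) => //; rewrite divr_gt0.
pose f (k : 'I_K) (y : caratheodory_type mu) : \bar R :=
  (c * ((2 `^ theta) ^+ k / nu (ball x (s / 2 ^+ k))) * \1_(ball x (s / 2 ^+ k)) y)%:E.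
have cf0 (k : nat) : 0 <= c * ((2 `^ theta) ^+ k / nu (ball x (s / 2 ^+ k))).
  by rewrite mulr_ge0 ?(ltW c0)// divr_ge0// ltW.
have mOE : mu.-cara.-measurable (Om `\` E) by exact: measurableD.
apply: (@le_trans _ _ (\int[cara_measure mu]_(y in Om `\` E)
    (\sum_(k <- [seq k : 'I_K <- index_enum 'I_K | J k]) f k y))%E); last first.
  apply: ge0_le_integral_nomeas => y [Oy nEy].
    by apply: sume_ge0 => k _; rewrite lee_fin mulr_ge0// indicE.
  have xy : x <> y by move=> xy; apply: nEy; rewrite -xy.
  apply: le_trans (frac_kernel_dyadic th0 s0 xy thK); rewrite big_filter sumEFin lee_fin.
  rewrite mulr_sumr big_mkcond; apply: ler_sum => k _.
  case: ifPn => _; first by rewrite -mulrA.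
  by rewrite mulr_ge0 ?(ltW c0)// mulr_ge0 ?indicE// divr_ge0// ltW.
rewrite ge0_integral_sum//; last 2 first.
- move=> k; apply/measurable_EFinP; apply: measurable_funM => //.
  by apply: measurable_indic; exact: ball_cara.
- by move=> k y _; rewrite lee_fin mulr_ge0// indicE.
rewrite big_filter mulr_sumr -sumEFin; apply: lee_sum => k Jk.
rewrite integral_scale_indic//; last exact: ball_cara.
have [kO kL] := HJ k (ltn_ord k) Jk.
have -> : ball x (s / 2 ^+ k) `&` (Om `\` E) = ball x (s / 2 ^+ k) `\` E.
  by apply/seteqP; split => y [h1 h2]; [case: h2|split => //; split => //; exact: kO].
have -> : cara_measure mu (ball x (s / 2 ^+ k) `\` E) =
    (nu (ball x (s / 2 ^+ k) `\` E))%:E by apply: (@muE _ x (s / 2 ^+ k)) => y [].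
rewrite -EFinM lee_fin invfM -/c -!mulrA ler_wpM2l ?(ltW c0)//.
by rewrite [leLHS]mulrC ler_wpM2l// ler_pdivlMl// ler_pdivrMr// [leRHS]mulrC.
Qed.

End kernel.

(** * Perimeter bounds from points of low density *)

Section perimeter_lower_bounds.
Context {R : realType} {X : pointedMetricType R}.
Variables (mu : {outer_measure set X -> \bar R}) (Cmu : R).
Hypothesis Cmu1 : 1 <= Cmu.
Hypothesis mu_reg : borel_regular mu.
Hypothesis mu_dbl : doubling mu Cmu.
Implicit Types (x y z : X) (A B E Om : set X) (theta s L : R) (K : nat).

Local Notation nu := (nu mu).
Local Notation muE := (muE Cmu1 mu_dbl).
Local Notation nu_le := (nu_le Cmu1 mu_dbl).
Local Notation nu_ball_le := (nu_ball_le Cmu1 mu_dbl).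
Local Notation P := (fractional_perimeter mu).

Let Cm0 : 0 < Cmu. Proof. exact: lt_le_trans ltr01 Cmu1. Qed.
Let C0 k : 0 < Cmu ^+ k. Proof. by rewrite exprn_gt0. Qed.

Lemma fractional_perimeter_ge0 theta E Om : (0 <= P theta E Om)%E.
Proof. by rewrite fractional_perimeterE; apply: integral_ge0 => x _; exact: frac_potential_ge0. Qed.

(** Interactions between different [W i] are dropped: the inner domain shrinks to [W i], and the
    outer ones are disjoint. *)
Lemma fractional_perimeter_superadd (I : eqType) (s : seq I) (W : I -> set X) theta E Om :
  uniq s -> {in s &, forall i j, i != j -> W i `&` W j = set0} ->
  (forall i, i \in s -> W i `<=` Om) ->
  (\sum_(i <- s) P theta E (W i) <= P theta E Om)%E.
Proof.
move=> us dW WO; rewrite fractional_perimeterE.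
apply: le_trans (@ge0_integral_disjoint_nomeas _ _ _ (cara_measure mu) _
  (fun i => W i `&` E) s _ _ us _ _ _); last 3 first.
- move=> i j si sj ij; rewrite -subset0 => x [[h1 _] [h2 _]].
  by rewrite -(dW i j si sj ij).
- by move=> i si; apply: setSI; exact: WO.
- by move=> x _; exact: frac_potential_ge0.
rewrite big_seq [leRHS]big_seq; apply: lee_sum => i si.
rewrite fractional_perimeterE; apply: ge0_le_integral_nomeas => x _.
  exact: frac_potential_ge0.
apply: ge0_integral_subset_nomeas; first by apply: setSD; exact: WO.
by move=> y _; exact: frac_kernel_ge0.
Qed.

(** Bounds dilation factors uniformly in [theta], so that the constants do not depend on it. *)
Lemma powR_dilate_le theta (c s : R) : 0 < theta < 1 -> 1 <= c -> 0 <= s ->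
  (c * s) `^ theta <= c * s `^ theta.
Proof.
move=> /andP[th0 th1] c1 s0; rewrite powRM//; last by rewrite (le_trans ler01).
by rewrite ler_wpM2r ?powR_ge0// ler1_powR// ltW.
Qed.

Lemma frac_potential_ge1 theta s L E Om x :
  0 < theta < 1 -> 0 < s -> 0 < L ->
  mu.-cara.-measurable E -> mu.-cara.-measurable Om -> E x -> ball x s `<=` Om ->
  nu (ball x s) <= L * nu (ball x s `\` E) ->
  ((4 * Cmu * s `^ theta * L)^-1%:E <= frac_potential mu theta E Om x)%E.
Proof.
move=> /andP[th0 th1] s0 L0 mE mO Ex xO xL.
have := @frac_potential_ge _ _ mu Cmu Cmu1 mu_reg mu_dbl theta s L 1 predT E Om x
  th0 s0 L0 (or_intror (leqnn 1)) mE mO Ex.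
rewrite big_ord_recr big_ord0 /= expr0 add0r mulr1; apply => -[|//] _ _.
by rewrite expr0 divr1.
Qed.

Lemma perimeter_ge_thin_inside theta s E Om (N : set X) x r :
  0 < theta < 1 -> 0 < s -> mu.-cara.-measurable E -> mu.-cara.-measurable Om ->
  N `<=` ball x r -> ball x (r + 3 * s) `<=` Om -> N `<=` E ->
  (forall h, N h -> nu (ball h s) <= 2 * nu (ball h s `\` E)) ->
  (((16 * Cmu ^+ 3 * s `^ theta)^-1 * nu N)%:E <= P theta E Om)%E.
Proof.
move=> th s0 mE mO Nb bO NE Nd; rewrite fractional_perimeterE.
pose U : set X := \bigcup_(h in N) ball h s.
have Ub : U `<=` ball x (r + s).
  by move=> y [h /Nb/ballP h1]; apply: ball_sub; lra.
have mU : mu.-cara.-measurable U.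
  by apply: open_cara => //; apply: bigcup_open => h _; exact: open_metric_ball.
have NUE : N `<=` U `&` E.
  by move=> h Nh; split; [exists h => //; apply/ballP; rewrite mdistxx|exact: NE].
have UEb : U `&` E `<=` ball x (r + s) by move=> y [/Ub].
have sp0 : 0 < s `^ theta by exact: powR_gt0.
have K0 : 0 < 16 * Cmu ^+ 3 * s `^ theta by rewrite !mulr_gt0.
apply: (@le_trans _ _ ((16 * Cmu ^+ 3 * s `^ theta)^-1%:E * cara_measure mu (U `&` E))%E).
  have -> : cara_measure mu (U `&` E) = (nu (U `&` E))%:E by exact: muE UEb.
  by rewrite -EFinM lee_fin ler_wpM2l ?invr_ge0 ?(ltW K0)//; exact: nu_le UEb.
apply: ge0_integral_ge_cst.
- exact: measurableI.
- move=> y [Uy Ey]; split => //; apply: bO.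
  by have /ballP := Ub _ Uy; move=> h; apply/ballP; lra.
- by move=> y _; exact: frac_potential_ge0.
- by rewrite invr_ge0 ltW.
move=> y [[h Nh /ballP hy] Ey].
have s20 : 0 < 2 * s by rewrite mulr_gt0.
have L0 : 0 < 2 * Cmu ^+ 2 by rewrite mulr_gt0.
apply: le_trans (@frac_potential_ge1 theta (2 * s) (2 * Cmu ^+ 2) E Om y th s20 L0 mE mO Ey _ _).
- rewrite lee_fin lef_pV2 ?posrE//; last by rewrite !mulr_gt0// powR_gt0.
  have := powR_dilate_le th (ler1n R 2) (ltW s0).
  have -> : 16 * Cmu ^+ 3 * s `^ theta = 8 * Cmu ^+ 3 * (2 * s `^ theta) by ring.
  have -> : 4 * Cmu * (2 * s) `^ theta * (2 * Cmu ^+ 2) = 8 * Cmu ^+ 3 * (2 * s) `^ theta by ring.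
  by move=> h'; rewrite ler_wpM2l// mulr_ge0// ltW.
- apply: subset_trans bO; apply: ball_sub; have /ballP := Nb _ Nh.
  by have := metric_triangle x h y; lra.
- apply: (@le_trans _ _ (Cmu ^+ 2 * nu (ball h s))); first by apply: nu_ball_le; lra.
  rewrite (mulrC 2 (Cmu ^+ 2)) -[leRHS]mulrA ler_wpM2l ?(ltW (C0 _))//.
  apply: le_trans (Nd _ Nh) _; rewrite ler_wpM2l//.
  apply: (@nu_le _ _ y (2 * s)); last by move=> z [].
  by apply: setSD; apply: ball_sub; rewrite metric_sym; lra.
Qed.

(* The points [x] of the outer integral run over the disjoint balls, while the
   points [y] run over the enlarged balls, which cover [N]. *)
Lemma perimeter_ge_thin_outside theta s E Om (N : set X) x r :
  0 < theta < 1 -> 0 < s -> mu.-cara.-measurable E -> mu.-cara.-measurable Om ->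
  N `<=` ball x r -> ball x (r + 9 * s) `<=` Om -> N `<=` ~` E ->
  (forall h, N h -> nu (ball h s) <= 2 * nu (ball h s `&` E)) ->
  (((64 * Cmu ^+ 5 * s `^ theta)^-1 * nu N)%:E <= P theta E Om)%E.
Proof.
move=> th s0 mE mO Nb bO NE Nd; rewrite fractional_perimeterE.
have [|l [ul lN dl cl]] := vitali_covering Cmu1 mu_reg mu_dbl (rad := fun _ => s) (M := s) s0 _ Nb.
  by move=> y _; rewrite lexx.
have sp0 : 0 < s `^ theta by exact: powR_gt0.
pose K := 64 * Cmu ^+ 5 * s `^ theta.
have K0 : 0 < K by rewrite !mulr_gt0.
have NbO y : N y -> ball y (9 * s) `<=` Om.
  by move=> /Nb/ballP h; apply: subset_trans bO; apply: ball_sub; lra.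
apply: (@le_trans _ _ (\sum_(y <- l) (K^-1 * nu (ball y (4 * s) `\` E))%:E)%E).
  rewrite sumEFin lee_fin -mulr_sumr ler_wpM2l ?invr_ge0 ?(ltW K0)//.
  apply: (@nu_cover_le _ _ _ _ Cmu1 mu_dbl _ _ _ _ x (r + 4 * s)).
    by move=> y /lN/Nb/ballP h z [/ballP hz _]; apply/ballP; have := metric_triangle x y z; lra.
  by move=> y Ny; have [z zl yz] := cl _ Ny; exists z => //; split => //; exact: NE.
apply: le_trans (@ge0_integral_disjoint_nomeas _ _ _ (cara_measure mu) _
  (fun y => ball y s `&` E) l _ _ ul _ _ _); last 3 first.
- move=> i j si sj ij; rewrite -subset0 => z [[h1 _] [h2 _]].
  by rewrite -(dl i j si sj ij).
- move=> y /lN Ny; apply: setSI; apply: subset_trans (NbO _ Ny).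
  by apply: ball_sub; rewrite mdistxx; lra.
- by move=> z _; exact: frac_potential_ge0.
rewrite big_seq [leRHS]big_seq; apply: lee_sum => h /lN Nh.
set v := nu (ball h (4 * s) `\` E).
(* Separated because [L] below divides by [v]. *)
have [v0|v0] := leP v 0.
  apply: (@le_trans _ _ 0%E); first by rewrite lee_fin pmulr_rle0 ?invr_gt0.
  by apply: integral_ge0 => z _; exact: frac_potential_ge0.
have s4 : 0 < 4 * s by rewrite mulr_gt0.
have V0 : 0 < nu (ball h (4 * s)) by exact: (nu_ball_gt0 Cmu1).
(* Now [L * v] bounds the measure of each [ball y (8 * s)] used below, so the inner integral is
   proportional to [v]; the mass of [E] in [ball h s] cancels [nu (ball h (4 * s))] up to
   constants. *)
pose L := Cmu ^+ 2 * nu (ball h (4 * s)) / v.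
have L0 : 0 < L by rewrite divr_gt0// mulr_gt0.
have bE : ball h s `&` E `<=` ball h s by move=> z [].
apply: (@le_trans _ _ ((32 * Cmu * s `^ theta * L)^-1%:E * cara_measure mu (ball h s `&` E))%E).
  have -> : cara_measure mu (ball h s `&` E) = (nu (ball h s `&` E))%:E by exact: muE bE.
  rewrite -EFinM lee_fin.
  have h1 : nu (ball h (4 * s)) <= Cmu ^+ 2 * nu (ball h s).
    by apply: nu_ball_le; rewrite mdistxx; lra.
  have h2 : nu (ball h (4 * s)) <= 2 * Cmu ^+ 2 * nu (ball h s `&` E).
    apply: le_trans h1 _; rewrite (mulrC 2 (Cmu ^+ 2)) -[leRHS]mulrA ler_wpM2l ?(ltW (C0 _))//.
    exact: Nd.
  have -> : (32 * Cmu * s `^ theta * L)^-1 =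
      K^-1 * v * ((2 * Cmu ^+ 2) / nu (ball h (4 * s))).
    by rewrite /L /K; field; rewrite !gt_eqF.
  rewrite -[leRHS]mulrA [X in _ <= _ * X]mulrAC.
  rewrite -[leLHS]mulr1 ler_wpM2l ?mulr_ge0 ?invr_ge0 ?(ltW K0) ?(ltW v0)//.
  by rewrite ler_pdivlMr// mul1r.
apply: ge0_integral_ge_cst => //.
- by apply: measurableI => //; exact: ball_cara.
- by move=> y _; exact: frac_potential_ge0.
- by apply/ltW; rewrite invr_gt0 mulr_gt0// !mulr_gt0.
move=> y [/ballP hy Ey].
have s80 : 0 < 8 * s by rewrite mulr_gt0.
apply: le_trans (@frac_potential_ge1 theta (8 * s) L E Om y th s80 L0 mE mO Ey _ _).
- have L32 : 0 < 32 * Cmu * s `^ theta * L by rewrite mulr_gt0// !mulr_gt0.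
  have L4 : 0 < 4 * Cmu * (8 * s) `^ theta * L.
    by rewrite mulr_gt0// !mulr_gt0// powR_gt0.
  rewrite lee_fin lef_pV2//.
  have := powR_dilate_le th (ler1n R 8) (ltW s0) => h'.
  have -> : 32 * Cmu * s `^ theta * L = 4 * Cmu * L * (8 * s `^ theta) by ring.
  have -> : 4 * Cmu * (8 * s) `^ theta * L = 4 * Cmu * L * (8 * s) `^ theta by ring.
  by rewrite ler_wpM2l// ltW// mulr_gt0// mulr_gt0.
- by apply: subset_trans (NbO _ Nh); apply: ball_sub; lra.
- apply: (@le_trans _ _ (Cmu ^+ 2 * nu (ball h (4 * s)))); first by apply: nu_ball_le; lra.
  have vle : v <= nu (ball y (8 * s) `\` E).
    apply: (@nu_le _ _ y (8 * s)); last by move=> z [].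
    by apply: setSD; apply: ball_sub; rewrite metric_sym; lra.
  have -> : Cmu ^+ 2 * nu (ball h (4 * s)) = L * v by rewrite /L divfK ?gt_eqF.
  by rewrite ler_wpM2l// ltW.
Qed.

End perimeter_lower_bounds.

(** * Balls in which both densities are bounded below *)

Definition dense_const {R : realType} (Cmu CP c : R) : R :=
  let K := 2 * Cmu ^+ 5 / c in 64 * Cmu * K * (2 / c * (1 + 2 * CP) * K).

Lemma dense_const_gt0 (R : realType) (Cmu CP c : R) :
  0 < Cmu -> 0 <= CP -> 0 < c -> 0 < dense_const Cmu CP c.
Proof.
move=> C0 P0 c0; rewrite /dense_const /=.
have : 0 < 2 * Cmu ^+ 5 / c by rewrite divr_gt0// mulr_gt0// exprn_gt0.
move: (2 * Cmu ^+ 5 / c) => K K0; rewrite !mulr_gt0// ?invr_gt0//; lra.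
Qed.

Section dense_balls.
Context {R : realType} {X : pointedMetricType R}.
Variables (mu : {outer_measure set X -> \bar R}) (Cmu CP tauP : R).
Hypothesis Cmu1 : 1 <= Cmu.
Hypothesis CP1 : 1 <= CP.
Hypothesis tauP1 : 1 <= tauP.
Hypothesis mu_reg : borel_regular mu.
Hypothesis mu_dbl : doubling mu Cmu.
Hypothesis mu_PI : poincare11 mu CP tauP.
Implicit Types (x y z : X) (A B E Om : set X) (theta s L : R).

Local Notation nu := (nu mu).
Local Notation muE := (muE Cmu1 mu_dbl).
Local Notation nu_le := (nu_le Cmu1 mu_dbl).
Local Notation P := (fractional_perimeter mu).

Let Cm0 : 0 < Cmu. Proof. exact: lt_le_trans ltr01 Cmu1. Qed.

(* The Poincare inequality at the scales [rho / 2^k] contributes the terms of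
   [dyadic_sum_ge], whose sum is of order [1 / (1 - theta)]. *)
Lemma dense_ball_perimeter theta E x0 (rho c : R) :
  0 < theta < 1 -> mu.-cara.-measurable E -> 0 < rho -> 0 < c -> c <= 1 ->
  c * nu (ball x0 rho) <= nu (ball x0 rho `&` E) ->
  c * nu (ball x0 rho) <= nu (ball x0 rho `\` E) ->
  (((dense_const Cmu CP c * (1 - theta) * rho `^ theta)^-1 * nu (ball x0 rho))%:E <=
   P theta E (ball x0 ((tauP + 12) * rho)))%E.
Proof.
move=> th mE rho0 c0 c1 cE cE'; rewrite /dense_const; set K := 2 * Cmu ^+ 5 / c.
have [th0 th1] := andP th.
rewrite /=; set K1 := 2 / c * (1 + 2 * CP) * K; set B := ball x0 rho in cE cE' *.
(* The 12 is the 4 of [one_scale] plus 8 for the balls of radius at most [8 * rho] centred in its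
   open set. *)
set Om := ball x0 ((tauP + 12) * rho).
have K0 : 0 < K by rewrite divr_gt0// mulr_gt0// exprn_gt0.
have K10 : 0 < K1 by rewrite mulr_gt0// mulr_gt0 ?divr_gt0//; move: CP1; lra.
have k0 k : 0 < 2 ^+ k :> R by rewrite exprn_gt0.
have k1 k : 1 <= 2 ^+ k :> R by rewrite exprn_ege1// ler1n.
have scale k : exists U : set X, [/\ open U, U `<=` ball x0 ((tauP + 4) * rho),
    nu B <= K1 * 2 ^+ k * nu (E `&` U) &
    forall x, U x -> nu (ball x (8 * rho / 2 ^+ k)) <=
      K * nu (ball x (8 * rho / 2 ^+ k) `\` E)].
  have tk : rho / 2 ^+ k <= rho by rewrite ler_pdivrMr// ler_peMr// ltW.
  have [] := @one_scale _ _ mu Cmu CP tauP Cmu1 CP1 tauP1 mu_reg mu_dbl mu_PI E x0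
    rho (rho / 2 ^+ k) c mE (divr_gt0 rho0 (k0 k)) tk c0 c1 cE cE'.
  move=> U [oU Ub UB Ud]; exists U; split => //.
    have -> : 2 ^+ k = rho / (rho / 2 ^+ k) by field; rewrite !gt_eqF.
    exact: UB.
  by move=> x /Ud; rewrite mulrA.
have {scale} [U HU] := choice scale.
clearbody K1; clearbody K.
have [n thn hn] := dyadic_sum_ge th.
have mOm : mu.-cara.-measurable Om by exact: ball_cara.
have mU k : mu.-cara.-measurable (U k) by have [oU _ _ _] := HU k; exact: open_cara.
pose a : R := 2 `^ theta.
have a0 k : 0 <= a ^+ k by rewrite exprn_ge0// powR_ge0.
pose c' := (4 * Cmu * (8 * rho) `^ theta * K)^-1.
have rho8 : 0 < 8 * rho by rewrite mulr_gt0.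
have rho8p : 0 < (8 * rho) `^ theta by exact: powR_gt0.
have c'0 : 0 < c' by rewrite invr_gt0 mulr_gt0// mulr_gt0// mulr_gt0.
(* At [x] the sum of the [f k] retains the scales with [x] in [U k]. Being multiples of indicators
   of open sets, they integrate term by term. *)
pose f (k : 'I_n) (x : caratheodory_type mu) : \bar R := (c' * a ^+ k * \1_(U k) x)%:E.
have UOm k : U k `<=` Om.
  have [_ Ub _ _] := HU k; apply: subset_trans Ub _; apply: ball_sub.
  by rewrite mdistxx add0r ler_pM2r//; lra.
have mOE : mu.-cara.-measurable (Om `&` E) by exact: measurableI.
apply: (@le_trans _ _ (\int[cara_measure mu]_(x in Om `&` E)
    (\sum_(k <- index_enum 'I_n) f k x))%E); last first.
  rewrite fractional_perimeterE; apply: ge0_le_integral_nomeas => x [Ox Ex].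
    by apply: sume_ge0 => k _; rewrite lee_fin indicE mulr_ge0// mulr_ge0// ltW.
  apply: le_trans (@frac_potential_ge _ _ mu Cmu Cmu1 mu_reg mu_dbl theta (8 * rho) K n
    (fun k => `[< U k x >]) E Om x th0 rho8 K0 thn mE mOm Ex _); last first.
    move=> k kn /asboolP Ux; have [_ Ub _ Ud] := HU k; split; last exact: Ud.
    apply: ball_sub; have /ballP := Ub _ Ux.
    have : 8 * rho / 2 ^+ k <= 8 * rho by rewrite ler_pdivrMr// ler_peMr// ltW.
    by rewrite !mulrDl; lra.
  rewrite sumEFin lee_fin mulr_sumr [leRHS]big_mkcond; apply: ler_sum => k _.
  rewrite indicE; case: (boolP (x \in U k)) => [/set_mem Ux|/negP nU]; last first.
    rewrite mulr0; case: ifPn => // _; rewrite mulr_ge0 ?a0// ltW//.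
  by rewrite asboolT// mulr1.
rewrite ge0_integral_sum//; last 2 first.
- by move=> k; apply/measurable_EFinP; exact: measurable_funM.
- by move=> k y _; rewrite lee_fin indicE mulr_ge0// mulr_ge0// ltW.
have intf (k : 'I_n) : (\int[cara_measure mu]_(x in Om `&` E) f k x)%E =
    (c' * a ^+ k * nu (E `&` U k))%:E.
  rewrite integral_scale_indic//; last by rewrite mulr_ge0// ltW.
  have -> : U k `&` (Om `&` E) = E `&` U k.
    by apply/seteqP; split => y [h1 h2]; [case: h2|split => //; split => //; exact: (UOm k)].
  have EUb : E `&` U k `<=` Om by move=> y [_ /UOm].
  by have -> : cara_measure mu (E `&` U k) = (nu (E `&` U k))%:E by exact: muE EUb.
under eq_bigr do rewrite intf.
rewrite sumEFin lee_fin.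
(* The mass of [E] in [U k] is at least [nu B / (K1 * 2 ^+ k)], which turns the weight [a ^+ k] into
   [(a / 2) ^+ k]. *)
have h1 : nu B * \sum_(k < n) (a / 2) ^+ k <= K1 / c' * \sum_(k < n) c' * a ^+ k * nu (E `&` U k).
  rewrite !mulr_sumr; apply: ler_sum => k _; have [_ _ UB _] := HU k.
  have -> : K1 / c' * (c' * a ^+ k * nu (E `&` U k)) =
      (K1 * 2 ^+ k * nu (E `&` U k)) * (a / 2) ^+ k.
    rewrite exprMn exprVn; field; by rewrite !gt_eqF.
  by rewrite ler_wpM2r// exprn_ge0// divr_ge0// powR_ge0.
set S := \sum_(k < n) c' * a ^+ k * nu (E `&` U k) in h1 *.
have S0 : 0 <= S by apply: sumr_ge0 => k _; rewrite !mulr_ge0 ?nu_ge0// ltW.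
have s0 : 0 < 1 - theta by rewrite subr_gt0.
have h2 : nu B <= 2 * (1 - theta) * (K1 / c' * S).
  apply: (@le_trans _ _ (2 * (1 - theta) * (nu B * \sum_(k < n) (a / 2) ^+ k))).
    rewrite mulrCA ler_peMr ?nu_ge0//.
  by rewrite ler_wpM2l// mulr_ge0// ltW.
have h3 : c'^-1 <= 32 * Cmu * rho `^ theta * K.
  rewrite /c' invrK; have := powR_dilate_le th (ler1n R 8) (ltW rho0) => h3.
  have -> : 32 * Cmu * rho `^ theta * K = 4 * Cmu * K * (8 * rho `^ theta) by ring.
  have -> : 4 * Cmu * (8 * rho) `^ theta * K = 4 * Cmu * K * (8 * rho) `^ theta by ring.
  by rewrite ler_wpM2l// ltW// !mulr_gt0.
rewrite mulrC ler_pdivrMr; last by rewrite !mulr_gt0// powR_gt0.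
apply: le_trans h2 _.
have -> : 2 * (1 - theta) * (K1 / c' * S) = (2 * (1 - theta) * K1 * S) * c'^-1 by ring.
have -> : S * (64 * Cmu * K * K1 * (1 - theta) * rho `^ theta) =
  (2 * (1 - theta) * K1 * S) * (32 * Cmu * rho `^ theta * K) by ring.
by rewrite ler_wpM2l// !mulr_ge0// ltW.
Qed.

End dense_balls.

(** * Subadditivity of powers *)

Section powR_sums.
Context {R : realType}.

(** A ratio [u / (a + b)] in the unit interval is at most its power of exponent [e]; add the cases
    [u = a] and [u = b]. *)
Lemma powRD_le (e a b : R) : 0 < e <= 1 -> 0 <= a -> 0 <= b ->
  (a + b) `^ e <= a `^ e + b `^ e.
Proof.
move=> /andP[e0 e1] a0 b0; have [ab|ab] := eqVneq (a + b) 0.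
  by rewrite ab powR0 ?gt_eqF// addr_ge0 ?powR_ge0.
have ab0 : 0 < a + b by rewrite lt_neqAle eq_sym ab addr_ge0.
have key (u : R) : 0 <= u -> u <= a + b -> u / (a + b) * (a + b) `^ e <= u `^ e.
  move=> u0 uab; have [->|un0] := eqVneq u 0; first by rewrite !mul0r powR_ge0.
  have ug : 0 < u by rewrite lt_neqAle eq_sym un0.
  rewrite -[in leRHS](divfK (lt0r_neq0 ab0) u) powRM ?(ltW ab0) ?divr_ge0 ?(ltW ab0)//.
  rewrite ler_wpM2r ?powR_ge0// ger1_powR// divr_gt0//= ler_pdivrMr// mul1r//.
have h1 : a <= a + b by rewrite lerDl.
have h2 : b <= a + b by rewrite lerDr.
have := lerD (key a a0 h1) (key b b0 h2); rewrite -mulrDl -mulrDl divff ?mul1r//.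
Qed.

Lemma powR_sum_le (I : eqType) (s : seq I) (F : I -> R) (e : R) :
  0 < e <= 1 -> (forall i, i \in s -> 0 <= F i) ->
  (\sum_(i <- s) F i) `^ e <= \sum_(i <- s) (F i) `^ e.
Proof.
move=> e01; elim: s => [|i s IH] F0.
  by rewrite !big_nil powR0// gt_eqF//; case/andP: e01.
rewrite !big_cons; apply: le_trans (powRD_le e01 _ _) _.
- by apply: F0; rewrite mem_head.
- by rewrite big_seq; apply: sumr_ge0 => j js; apply: F0; rewrite inE js orbT.
by rewrite lerD2l; apply: IH => j js; apply: F0; rewrite inE js orbT.
Qed.

End powR_sums.

(** * The relative isoperimetric inequality *)

Section relative_isoperimetry.
Context {R : realType} {X : pointedMetricType R}.
Variables (mu : {outer_measure set X -> \bar R}) (Cmu CP tauP : R).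
Hypothesis Cmu1 : 1 <= Cmu.
Hypothesis CP1 : 1 <= CP.
Hypothesis tauP1 : 1 <= tauP.
Hypothesis mu_reg : borel_regular mu.
Hypothesis mu_dbl : doubling mu Cmu.
Hypothesis mu_PI : poincare11 mu CP tauP.
Implicit Types (x y z : X) (A B E Om : set X).

Local Notation nu := (nu mu).
Local Notation muE := (muE Cmu1 mu_dbl).
Local Notation mu_ballE := (mu_ballE Cmu1 mu_dbl).
Local Notation nu_le := (nu_le Cmu1 mu_dbl).
Local Notation nu_split := (nu_split Cmu1 mu_dbl).
Local Notation nu_ball_le := (nu_ball_le Cmu1 mu_dbl).
Local Notation P := (fractional_perimeter mu).

Let Cm0 : 0 < Cmu. Proof. exact: lt_le_trans ltr01 Cmu1. Qed.
(** If the complement of [A] fills at least half of [ball x0 r], it has this density in every ball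
    of radius [2 * r] centred there, whose measure is at most [Cmu ^+ 2] times larger. *)
Let c1 : R := (2 * Cmu ^+ 2)^-1.
Let c10 : 0 < c1. Proof. by rewrite invr_gt0 mulr_gt0// exprn_gt0. Qed.
Let C2 : 1 <= Cmu ^+ 2. Proof. by rewrite exprn_ege1. Qed.
Let c12 : c1 <= 1 / 2.
Proof. by rewrite mul1r lef_pV2 ?posrE ?mulr_gt0 ?exprn_gt0// ler_peMr. Qed.
Let c1C : 2 * Cmu * c1 <= 1.
Proof.
rewrite ler_pdivrMr ?mulr_gt0 ?exprn_gt0// mul1r ler_pM2l//.
by rewrite expr2 ler_peMr// ltW.
Qed.

Definition dense_ball A x (rho : R) :=
  c1 * nu (ball x rho) <= nu (ball x rho `&` A) /\
  c1 * nu (ball x rho) <= nu (ball x rho `\` A).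

(* Stop at the first scale where [A] is not sparse: at the previous scale [A]
   was sparse, so doubling leaves room for the complement as well. *)
Lemma stopping_scale A x0 x (r : R) J : mu.-cara.-measurable A -> 0 < r ->
  ball x0 r x -> nu (ball x0 r `&` A) <= nu (ball x0 r `\` A) ->
  (exists2 j, (j <= J)%N & dense_ball A x (2 * r / 2 ^+ j)) \/
  nu (ball x (2 * r / 2 ^+ J)) <= 2 * nu (ball x (2 * r / 2 ^+ J) `\` A).
Proof.
move=> mA r0 /ballP x0x small.
have [|none] := pselect (exists2 j, (j <= J)%N & dense_ball A x (2 * r / 2 ^+ j)).
  by left.
right; have spl (rho : R) :
    nu (ball x rho) = nu (ball x rho `&` A) + nu (ball x rho `\` A).
  by apply: (@nu_split _ _ x rho).
have V0 (rho : R) := nu_ge0 mu (ball x rho).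
(* Sparseness is carried with the factor [2 * Cmu]: halving the radius loses [Cmu], so the
   complement keeps half of the next ball. That ball is not dense, so [A] has density below [c1] and
   the factor is recovered. *)
suff low : forall j, (j <= J)%N ->
    2 * Cmu * nu (ball x (2 * r / 2 ^+ j) `&` A) <= nu (ball x (2 * r / 2 ^+ j)).
  have := low J (leqnn J); have := spl (2 * r / 2 ^+ J).
  have : nu (ball x (2 * r / 2 ^+ J) `&` A) <= Cmu * nu (ball x (2 * r / 2 ^+ J) `&` A).
    by rewrite ler_peMl// nu_ge0.
  lra.
have sparse j : (j <= J)%N ->
    c1 * nu (ball x (2 * r / 2 ^+ j)) <= nu (ball x (2 * r / 2 ^+ j) `\` A) ->
    2 * Cmu * nu (ball x (2 * r / 2 ^+ j) `&` A) <= nu (ball x (2 * r / 2 ^+ j)).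
  move=> jJ hc; have [h|/ltW h] := leP (c1 * nu (ball x (2 * r / 2 ^+ j)))
      (nu (ball x (2 * r / 2 ^+ j) `&` A)).
    by exfalso; apply: none; exists j.
  apply: (@le_trans _ _ (2 * Cmu * c1 * nu (ball x (2 * r / 2 ^+ j)))).
    by rewrite -[leRHS]mulrA ler_wpM2l// mulr_ge0// ltW.
  by rewrite -[leRHS]mul1r ler_wpM2r.
elim=> [_|j IH jJ]; apply: sparse => //.
  rewrite expr0 divr1 /c1 mulrC ler_pdivrMr ?mulr_gt0 ?exprn_gt0//.
  have h1 : nu (ball x (2 * r)) <= Cmu ^+ 2 * nu (ball x0 r) by apply: nu_ball_le; lra.
  have h2 : nu (ball x0 r `\` A) <= nu (ball x (2 * r) `\` A).
    apply: (@nu_le _ _ x (2 * r)); last by move=> z [].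
    by apply: setSD; apply: ball_sub; rewrite metric_sym; lra.
  have h3 : nu (ball x0 r) = nu (ball x0 r `&` A) + nu (ball x0 r `\` A).
    by apply: (@nu_split _ _ x0 r).
  have h4 : nu (ball x0 r) <= 2 * nu (ball x (2 * r) `\` A) by lra.
  apply: le_trans h1 _.
  have := ler_wpM2l (le_trans ler01 C2) h4; lra.
set V := nu (ball x (2 * r / 2 ^+ j.+1)).
have h1 : nu (ball x (2 * r / 2 ^+ j)) <= Cmu ^+ 1 * V.
  apply: nu_ball_le; rewrite mdistxx add0r expr1 exprS invfM.
  by rewrite mulrCA [2 * (2^-1 * _)]mulrA divff// mul1r.
have h2 : nu (ball x (2 * r / 2 ^+ j.+1) `&` A) <= nu (ball x (2 * r / 2 ^+ j) `&` A).
  apply: (@nu_le _ _ x (2 * r / 2 ^+ j)); last by move=> z [].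
  apply: setSI; apply: ball_sub; rewrite mdistxx add0r ler_pM2l ?mulr_gt0//.
  by rewrite lef_pV2 ?posrE ?exprn_gt0// ler_eXn2l// ltr1n.
have h3 := IH (ltnW jJ).
have h4 : 2 * nu (ball x (2 * r / 2 ^+ j.+1) `&` A) <= V.
  rewrite expr1 in h1; rewrite -(@ler_pM2l _ Cmu)//.
  have := ler_wpM2l (ltW Cm0) h2; lra.
have h5 := spl (2 * r / 2 ^+ j.+1); rewrite -/V in h5.
have : c1 * V <= 1 / 2 * V by rewrite ler_wpM2r// nu_ge0.
lra.
Qed.

Lemma dyadic_large (Y : R) : exists J : nat, Y <= 2 ^+ J.
Proof.
exists (Num.truncn Y).+1; apply/ltW/(lt_le_trans (truncnS_gt _)).
by rewrite -natrX ler_nat ltnW// ltn_expl.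
Qed.

Lemma powR_dyadic_small theta (r e : R) : 0 < theta -> 0 < r -> 0 < e ->
  exists J : nat, (r / 2 ^+ J) `^ theta <= e.
Proof.
move=> th0 r0 e0; have [J hJ] := dyadic_large (r / e `^ (theta^-1)); exists J.
have k0 : 0 < 2 ^+ J :> R by rewrite exprn_gt0.
have ep : 0 < e `^ (theta^-1) by exact: powR_gt0.
have : r / 2 ^+ J <= e `^ (theta^-1).
  by rewrite ler_pdivrMr// mulrC -ler_pdivrMr.
move=> h; apply: (@le_trans _ _ ((e `^ (theta^-1)) `^ theta)).
  apply: ge0_ler_powR => //; first exact: ltW.
  - by rewrite nnegrE divr_ge0// ltW.
  - by rewrite nnegrE ltW.
by rewrite -powRrM mulVf ?gt_eqF// powRr1// ltW.
Qed.

(** [E] and its complement play different roles in the iterated integral, so the two choices of [A]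
    need different estimates; the larger constant covers both. *)
Lemma perimeter_ge_sparse theta E A Om (N : set X) x (r s : R) :
  0 < theta < 1 -> 0 < s -> mu.-cara.-measurable E -> mu.-cara.-measurable Om ->
  A = E \/ A = ~` E -> N `<=` ball x r -> ball x (r + 9 * s) `<=` Om -> N `<=` A ->
  (forall h, N h -> nu (ball h s) <= 2 * nu (ball h s `\` A)) ->
  (((64 * Cmu ^+ 5 * s `^ theta)^-1 * nu N)%:E <= P theta E Om)%E.
Proof.
move=> th s0 mE mO AE Nb bO NA Nd.
have sp0 : 0 < s `^ theta by exact: powR_gt0.
case: AE => AE; rewrite {}AE in NA Nd.
  apply: le_trans (@perimeter_ge_thin_inside _ _ mu Cmu Cmu1 mu_reg mu_dbl theta s E Om N x r
    th s0 mE mO Nb _ NA Nd); last first.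
    by apply: subset_trans bO; apply: ball_sub; rewrite mdistxx; lra.
  rewrite lee_fin ler_wpM2r ?nu_ge0// lef_pV2 ?posrE ?mulr_gt0 ?exprn_gt0//.
  rewrite ler_wpM2r ?(ltW sp0)// ler_pM// ?exprn_ge0 ?(ltW Cm0)//; first by lra.
  exact: ler_weXn2l.
apply: (@perimeter_ge_thin_outside _ _ mu Cmu Cmu1 mu_reg mu_dbl theta s E Om N x r) => //.
by move=> h Nh; have := Nd h Nh; rewrite setDE setCK.
Qed.

(** With [n] doublings covering the factor [4 * (tauP + 12)], [Cmu ^+ n] is paid once for the Vitali
    enlargement and once for comparing the large ball with the given one. The 4 comes from covering
    only half of the small part and from the radius [2 * r]. *)
Definition isoperimetric_const (C0 : R) : R :=
  4 * Cmu ^+ (2 * (Num.truncn (4 * (tauP + 12))).+1) * C0 * dense_const Cmu CP c1.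

Lemma isoperimetric_const_gt0 (C0 : R) : 0 < C0 -> 0 < isoperimetric_const C0.
Proof.
move=> C00; rewrite mulr_gt0// ?dense_const_gt0//; last exact: le_trans CP1.
by rewrite !mulr_gt0// exprn_gt0.
Qed.

Lemma perimeter_ge_small_part theta (C0 Q : R) E A x0 (r : R) :
  0 < theta < 1 -> 1 <= C0 -> 1 < Q -> lower_mass_bound mu C0 Q ->
  mu.-cara.-measurable E -> A = E \/ A = ~` E -> 0 < r ->
  nu (ball x0 r `&` A) <= nu (ball x0 r `\` A) ->
  (((nu (ball x0 r `&` A) / nu (ball x0 r)) `^ (1 - theta / Q))%:E <=
   (isoperimetric_const C0 * (1 - theta) * r `^ theta)%:E *
   (P theta E (ball x0 (3 * (tauP + 12) * r)) / mu (ball x0 (3 * (tauP + 12) * r))))%E.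
Proof.
move=> th C01 Q1 lmb mE AE r0 small.
have [th0 th1] := andP th.
have s0 : 0 < 1 - theta by rewrite subr_gt0.
have rp0 : 0 < r `^ theta by exact: powR_gt0.
have Q0 : 0 < Q by lra.
have C00 : 0 < C0 by lra.
pose tau := tauP + 12; have tau13 : 13 <= tau by rewrite /tau; move: tauP1; lra.
set Om := ball x0 (3 * (tauP + 12) * r); set B := ball x0 r in small *.
have [Kd KdE Kd0] : exists2 Kd, Kd = dense_const Cmu CP c1 & 0 < Kd.
  by eexists; first reflexivity; apply: dense_const_gt0 => //; exact: le_trans CP1.
pose n := (Num.truncn (4 * (tauP + 12))).+1.
have n4 : 4 * tau <= 2 ^+ n.
  apply/ltW/(lt_le_trans (truncnS_gt _)).
  by rewrite -natrX ler_nat ltnW// ltn_expl.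
have Kf : isoperimetric_const C0 = 4 * Cmu ^+ (2 * n) * C0 * Kd by rewrite KdE.
have Kf0 := isoperimetric_const_gt0 C00.
move: (isoperimetric_const C0) Kf Kf0 => KF Kf Kf0.
have Om0 : 0 < nu Om.
  by apply: (nu_ball_gt0 Cmu1) => //; rewrite mulr_gt0//; move: tau13; rewrite /tau; lra.
have B0 : 0 < nu B by exact: (nu_ball_gt0 Cmu1).
have OmB : nu Om <= Cmu ^+ n * nu B.
  apply: nu_ball_le; rewrite mdistxx add0r ler_pM2r//; rewrite -/tau; lra.
have mA : mu.-cara.-measurable A by case: AE => ->//; exact: measurableC.
have mOm : mu.-cara.-measurable Om by exact: ball_cara.
have P0 := fractional_perimeter_ge0 mu theta E Om.
rewrite mu_ballE inver gt_eqF//.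
have [Poo|Pfin] := eqVneq (P theta E Om) +oo%E.
  rewrite Poo gt0_mulye ?lte_fin ?invr_gt0// gt0_muley ?leey// lte_fin.
  by rewrite !mulr_gt0.
have {Pfin} Pnum : P theta E Om \is a fin_num by rewrite ge0_fin_numE// ltey.
have [p pE] : exists p : R, P theta E Om = p%:E by exists (fine (P theta E Om)); rewrite fineK.
have p0 : 0 <= p by rewrite -lee_fin -pE.
rewrite pE -!EFinM lee_fin.
set m := nu (B `&` A) in small *.
set e := 1 - theta / Q.
have thQ : 0 < theta / Q < 1 by rewrite divr_gt0//= ltr_pdivrMr//; lra.
have e01 : 0 < e <= 1 by rewrite /e; case/andP: thQ => ? ?; apply/andP; split; lra.
have [m0|m0] := leP m 0.
  have -> : m = 0 by apply/eqP; rewrite eq_le m0 nu_ge0.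
  rewrite mul0r powR0; last by rewrite gt_eqF//; case/andP: e01.
  by rewrite !mulr_ge0// ?invr_ge0 ltW.
have C5 : 0 < 64 * Cmu ^+ 5 by rewrite mulr_gt0// exprn_gt0.
(* The finest scale depends on the finite perimeter [p]: the points of [N], sparse at that scale,
   then fill at most half of [m]. Using [p + 1] avoids a division by zero. *)
have [J hJ] : exists J : nat, 64 * Cmu ^+ 5 * (2 * r / 2 ^+ J) `^ theta * p <= m / 2.
  have [||J hJ] := @powR_dyadic_small theta (2 * r) (m / 2 / (64 * Cmu ^+ 5) / (p + 1)) th0.
  - by rewrite mulr_gt0.
  - by rewrite !divr_gt0// ltr_pwDr.
  exists J; move: hJ; rewrite ler_pdivlMr ?ltr_pwDr// ler_pdivlMr//.
  have := mulr_ge0 (ltW C5) (powR_ge0 (2 * r / 2 ^+ J) theta).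
  by move: (_ `^ theta) => w; lra.
pose good x (rho : R) := [/\ 2 * r / 2 ^+ J <= rho, rho <= 2 * r & dense_ball A x rho].
pose D := [set x | (B `&` A) x /\ exists rho, good x rho].
pose N := [set x | (B `&` A) x /\
  nu (ball x (2 * r / 2 ^+ J)) <= 2 * nu (ball x (2 * r / 2 ^+ J) `\` A)].
have kJ0 : 0 < 2 ^+ J :> R by rewrite exprn_gt0.
have DN : B `&` A `<=` D `|` N.
  move=> x [Bx Ax]; have [[j jJ dj]|h] := stopping_scale J mA r0 Bx small; last by right.
  left; split => //; exists (2 * r / 2 ^+ j); split => //.
    by rewrite ler_pM2l ?mulr_gt0// lef_pV2 ?posrE ?exprn_gt0// ler_weXn2l ?ler1n.
  by rewrite ler_pdivrMr ?exprn_gt0// ler_peMr ?mulr_ge0 ?(ltW r0)// exprn_ege1// ler1n.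
have DB : D `<=` B by move=> x [[]].
have NB : N `<=` B by move=> x [[]].
have sJ0 : 0 < 2 * r / 2 ^+ J by rewrite divr_gt0// mulr_gt0.
have sJ2 : 2 * r / 2 ^+ J <= 2 * r.
  by rewrite ler_pdivrMr// ler_peMr ?mulr_ge0 ?(ltW r0)// exprn_ege1// ler1n.
have tr : 39 * r <= 3 * (tauP + 12) * r by rewrite ler_pM2r//; rewrite -/tau; lra.
have NP : nu N <= m / 2.
  have : (((64 * Cmu ^+ 5 * (2 * r / 2 ^+ J) `^ theta)^-1 * nu N)%:E <= P theta E Om)%E.
    apply: (@perimeter_ge_sparse theta E A Om N x0 r (2 * r / 2 ^+ J)) => //.
    - by apply: ball_sub; rewrite mdistxx; lra.
    - by move=> x [[]].
    - by move=> x [].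
  rewrite pE lee_fin ler_pdivrMl ?mulr_gt0 ?powR_gt0//.
  by move=> h; exact: le_trans h hJ.
have mD : m / 2 <= nu D.
  have DNB : D `|` N `<=` ball x0 r by move=> x [/DB|/NB].
  have := nuU Cmu1 mu_dbl DNB; have := nu_le DN DNB; rewrite -/m; lra.
have [rho Hrho] : exists rho : X -> R, forall x, D x -> good x (rho x).
  have : forall x, exists v, D x -> good x v.
    move=> x; have [[_ [v hv]]|nD] := pselect (D x); first by exists v.
    by exists 0.
  by move=> /choice[f hf]; exists f.
have tau0 : 0 < tau by lra.
have rho0 x : D x -> 0 < rho x by move=> /Hrho[h _ _]; exact: lt_le_trans h.
(* Selecting among the balls enlarged by [tau] makes the sets carrying the perimeter disjoint. With
   radii at most [2 * r] they lie in the ball of radius [3 * tau * r]. *)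
have [||l [ul lD dl cl]] := @vitali_covering _ _ mu Cmu Cmu1 mu_reg mu_dbl D
  (fun x => tau * rho x) (tau * (2 * r / 2 ^+ J)) (tau * (2 * r)) x0 r _ _ DB.
- by rewrite mulr_gt0.
- by move=> x /Hrho[h1 h2 _]; rewrite !ler_pM2l// h1 h2.
pose a x := nu (ball x (rho x)) / nu B.
have a0 x : 0 <= a x by rewrite divr_ge0 ?nu_ge0.
have cover : m / nu B <= 2 * Cmu ^+ n * \sum_(x <- l) a x.
  rewrite -mulr_suml mulrA ler_pM2r ?invr_gt0//.
  suff : nu D <= Cmu ^+ n * \sum_(x <- l) nu (ball x (rho x)) by lra.
  apply: (@le_trans _ _ (\sum_(x <- l) nu (ball x (4 * (tau * rho x))))).
    apply: (@nu_cover_le _ _ _ _ Cmu1 mu_dbl _ _ _ _ x0 (r + 4 * (tau * (2 * r)))) => //.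
    move=> x /lD Dx; apply: ball_sub; have /ballP := DB _ Dx.
    have [_ h _] := Hrho _ Dx; have := ler_wpM2l (ltW tau0) h; lra.
  rewrite mulr_sumr big_seq [leRHS]big_seq; apply: ler_sum => x /lD Dx.
  apply: nu_ball_le; rewrite mdistxx add0r mulrA.
  by rewrite ler_wpM2r// ltW// rho0.
have rhop x : D x -> 0 < rho x `^ theta by move=> Dx; apply: powR_gt0; exact: rho0.
have perim : \sum_(x <- l) nu (ball x (rho x)) / rho x `^ theta <= Kd * (1 - theta) * p.
  rewrite [leRHS]mulrC -ler_pdivrMr ?mulr_gt0// mulr_suml.
  rewrite -lee_fin -pE -sumEFin.
  apply: le_trans (@fractional_perimeter_superadd _ _ mu _ l
    (fun x => ball x (tau * rho x)) theta E Om ul dl _); last first.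
    move=> x /lD Dx; apply: ball_sub; have /ballP := DB _ Dx.
    have [_ h _] := Hrho _ Dx; have := ler_wpM2l (ltW tau0) h.
    have : r <= tau * r by rewrite ler_peMl// ?(ltW r0)//; lra.
    rewrite -/tau; lra.
  rewrite big_seq [leRHS]big_seq; apply: lee_sum => x /lD Dx.
  have [_ _ [d1 d2]] := Hrho _ Dx.
  have c11 : c1 <= 1 by move: c12; lra.
  have dE : c1 * nu (ball x (rho x)) <= nu (ball x (rho x) `&` E) /\
      c1 * nu (ball x (rho x)) <= nu (ball x (rho x) `\` E).
    by case: AE => AE; move: d1 d2; rewrite AE// setDE setCK -setDE.
  apply: le_trans (@dense_ball_perimeter _ _ mu Cmu CP tauP Cmu1 CP1 tauP1 mu_reg mu_dbl
    mu_PI theta E x (rho x) c1 th mE (rho0 _ Dx) c10 c11 dE.1 dE.2).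
  by rewrite lee_fin -KdE [in leRHS]invfM [leRHS]mulrC mulrAC mulrA.
(* Split [a x] into its powers of exponents [e] and [theta / Q]. The lower mass bound makes the
   second one compensate the division by the power of [rho x]. *)
have term x : x \in l -> nu B * (a x) `^ e <=
    C0 * (2 * r) `^ theta * (nu (ball x (rho x)) / rho x `^ theta).
  move=> /lD Dx; have r20 : 0 < 2 * r by rewrite mulr_gt0.
  have V0 : 0 < nu (ball x (rho x)) by apply: (nu_ball_gt0 Cmu1) => //; exact: rho0.
  have ax : 0 < a x by rewrite divr_gt0.
  have aE : nu (ball x (rho x)) = nu B * ((a x) `^ e * (a x) `^ (theta / Q)).
    rewrite -powRD; last by rewrite /e subrK oner_eq0.
    by rewrite /e subrK powRr1 ?(ltW ax)// /a mulrCA divff ?mulr1// gt_eqF.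
  have rle : rho x `^ theta <= C0 * (2 * r) `^ theta * (a x) `^ (theta / Q).
    have [_ rho2 _] := Hrho _ Dx.
    have q0 : 0 < rho x / (2 * r) by rewrite divr_gt0// rho0.
    have h1 : (rho x / (2 * r)) `^ Q <= C0 * a x.
      have x2r : ball x0 (2 * r) x by apply/ballP; have /ballP := DB _ Dx; lra.
      have := @lmb x0 x (rho x) (2 * r) (rho0 _ Dx) rho2 x2r.
      rewrite !mu_ballE inver gt_eqF//; last exact: (nu_ball_gt0 Cmu1).
      rewrite -EFinM lee_fin ler_pdivrMl// => /le_trans; apply.
      rewrite ler_pM2l// ler_pM2l// lef_pV2 ?posrE//; last exact: (nu_ball_gt0 Cmu1).
      by apply: (nu_le_ball Cmu1) => //; apply: ball_sub; rewrite mdistxx; lra.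
    have -> : rho x `^ theta = (2 * r) `^ theta * (rho x / (2 * r)) `^ theta.
      rewrite -powRM ?(ltW r20) ?(ltW q0)//; congr (_ `^ _).
      by rewrite mulrCA divff ?mulr1// gt_eqF.
    rewrite [C0 * _]mulrC -[leRHS]mulrA ler_wpM2l ?powR_ge0//.
    have -> : theta = Q * (theta / Q) by rewrite mulrCA divff ?mulr1// gt_eqF.
    rewrite powRrM; apply: (@le_trans _ _ ((C0 * a x) `^ (theta / Q))).
      apply: ge0_ler_powR => //; rewrite ?nnegrE ?powR_ge0//.
      - by case/andP: thQ => /ltW.
      - by rewrite mulr_ge0// ltW.
    have -> : Q * (theta / Q) / Q = theta / Q by rewrite mulrC mulrA mulVf ?mul1r// gt_eqF.
    exact: powR_dilate_le.
  rewrite mulrA ler_pdivlMr ?rhop//.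
  apply: le_trans (ler_wpM2l _ rle) _; first by rewrite mulr_ge0 ?powR_ge0// ltW.
  by rewrite aE le_eqVlt; apply/orP; left; apply/eqP; ring.
have sums : nu B * \sum_(x <- l) (a x) `^ e <= C0 * (2 * r) `^ theta * (Kd * (1 - theta) * p).
  rewrite mulr_sumr; apply: (@le_trans _ _ (\sum_(x <- l)
      C0 * (2 * r) `^ theta * (nu (ball x (rho x)) / rho x `^ theta))).
    by rewrite big_seq [leRHS]big_seq; apply: ler_sum.
  by rewrite -mulr_sumr ler_wpM2l// mulr_ge0 ?powR_ge0// ltW.
have Cn0 : 0 < Cmu ^+ n by rewrite exprn_gt0.
have Cn1 : 1 <= 2 * Cmu ^+ n by have := exprn_ege1 n Cmu1; lra.
have S0 : 0 <= \sum_(x <- l) a x by apply: sumr_ge0.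
(* As [e <= 1], the power is subadditive and does not enlarge the constant, which is at least 1. *)
have final1 : (m / nu B) `^ e <= 2 * Cmu ^+ n * \sum_(x <- l) (a x) `^ e.
  have e0 : 0 <= e by case/andP: e01 => /ltW.
  apply: (@le_trans _ _ ((2 * Cmu ^+ n * \sum_(x <- l) a x) `^ e)).
    apply: ge0_ler_powR => //; rewrite nnegrE; first by rewrite divr_ge0// ltW.
    by rewrite !mulr_ge0// ltW.
  rewrite powRM//; last by rewrite mulr_ge0// ltW.
  apply: ler_pM; rewrite ?powR_ge0//; last by apply: powR_sum_le.
  by apply: ler1_powR => //; case/andP: e01.
apply: le_trans final1 _; rewrite Kf mulrA ler_pdivlMr//.
set S := \sum_(x <- l) (a x) `^ e in sums *.
have S'0 : 0 <= S by apply: sumr_ge0 => x _; exact: powR_ge0.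
apply: (@le_trans _ _ (2 * Cmu ^+ n * S * (Cmu ^+ n * nu B))).
  by rewrite ler_wpM2l// !mulr_ge0// ltW.
have h2r := powR_dilate_le th (ler1n R 2) (ltW r0).
have h3 : nu B * S <= C0 * (2 * r `^ theta) * (Kd * (1 - theta) * p).
  apply: le_trans sums _; apply: ler_wpM2r; first by rewrite !mulr_ge0// ltW.
  by rewrite ler_wpM2l// ltW.
have -> : 2 * Cmu ^+ n * S * (Cmu ^+ n * nu B) = 2 * Cmu ^+ (2 * n) * (nu B * S).
  by rewrite mul2n -addnn exprD; ring.
have -> : 4 * Cmu ^+ (2 * n) * C0 * Kd * (1 - theta) * r `^ theta * p =
   2 * Cmu ^+ (2 * n) * (C0 * (2 * r `^ theta) * (Kd * (1 - theta) * p)) by ring.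
by rewrite ler_wpM2l// mulr_ge0// exprn_ge0// ltW.
Qed.

End relative_isoperimetry.

Theorem corollary1p2 (R : realType) (C0 Qd : R -> R)
    (hQd : relative_lower_mass_exponent C0 Qd)
    (Cmu CP tauP : R) (hCmu : 1 <= Cmu) (hCP : 1 <= CP) (htauP : 1 <= tauP) :
  exists C tau : R, [/\ 1 <= C, 1 <= tau &
    forall (X : completeMetricType R) (mu : {outer_measure set X -> \bar R}),
      borel_regular mu -> doubling mu Cmu -> poincare11 mu CP tauP ->
      forall theta q : R, 0 < theta < 1 ->
        1 <= q <= Qd Cmu / (Qd Cmu - theta) ->
        forall E : set X, mu.-cara.-measurable E ->
          forall (x : X) (r : R), 0 < r ->
            ((mine (mu (ball x r `&` E)) (mu (ball x r `\` E))
                / mu (ball x r)) `^ q^-1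
             <= (C * (1 - theta) * r `^ theta)%:E *
                (fractional_perimeter mu theta E (ball x (tau * r))
                   / mu (ball x (tau * r))))%E].
Proof.
have [C01 Q1 lmbQ] := hQd Cmu hCmu.
have C00 : 0 < C0 Cmu by exact: lt_le_trans ltr01 C01.
have CK := isoperimetric_const_gt0 tauP hCmu hCP C00.
set K := isoperimetric_const Cmu CP tauP (C0 Cmu) in CK.
(* The summand 1 ensures that the constant is at least 1. *)
exists (1 + K), (3 * (tauP + 12)); split.
- by rewrite lerDl ltW.
- by lra.
move=> X mu mu_reg mu_dbl mu_PI theta q th /andP[q1 qQ] E mE x r r0.
have {lmbQ} lmb := lmbQ X mu mu_reg mu_dbl; set Q := Qd Cmu in Q1 lmb qQ.
have [th0 th1] := andP th.
have BE : ball x r `&` E `<=` ball x r by move=> y [].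
have BDE : ball x r `\` E `<=` ball x r by move=> y [].
have B0 : 0 < nu mu (ball x r) by exact: (nu_ball_gt0 hCmu).
set v := Num.min (nu mu (ball x r `&` E)) (nu mu (ball x r `\` E)) / nu mu (ball x r).
have vE : (mine (mu (ball x r `&` E)) (mu (ball x r `\` E)) / mu (ball x r) = v%:E)%E.
  rewrite (muE hCmu mu_dbl BE) (muE hCmu mu_dbl BDE) (mu_ballE hCmu mu_dbl) -EFin_min.
  by rewrite inver gt_eqF.
have v01 : 0 <= v <= 1.
  rewrite divr_ge0 ?le_min ?nu_ge0//= ler_pdivrMr// mul1r ge_min.
  by rewrite (nu_le_ball hCmu mu_dbl BE).
(* [1 - theta / Q] is the exponent for the largest [q]. Since [v <= 1], the larger exponent [q^-1]
   can only decrease the power. *)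
have e_le : 1 - theta / Q <= q^-1.
  have Q0 : 0 < Q by lra.
  have Qth : 0 < Q - theta by lra.
  have -> : 1 - theta / Q = (Q / (Q - theta))^-1 by field; rewrite !gt_eqF.
  have q0 : 0 < q by exact: lt_le_trans q1.
  by rewrite lef_pV2// posrE divr_gt0.
rewrite vE poweR_EFin.
apply: (@le_trans _ _ (v `^ (1 - theta / Q))%:E).
  rewrite lee_fin; have [->|v0] := eqVneq v 0.
    by rewrite powR0 ?powR_ge0// invr_eq0 gt_eqF//; lra.
  case/andP: v01 => v0' v1; apply: ger_powR => //.
  by rewrite lt_neqAle eq_sym v0 v0' v1.
set X' := (fractional_perimeter mu theta E _ / _)%E.
have X'0 : (0 <= X')%E.
  by rewrite mule_ge0 ?fractional_perimeter_ge0// inve_ge0 outer_measure_ge0.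
apply: (@le_trans _ _ ((K * (1 - theta) * r `^ theta)%:E * X')%E); last first.
  rewrite lee_wpmul2r// lee_fin -[leLHS]mulrA -[leRHS]mulrA.
  by rewrite ler_wpM2r ?lerDr// mulr_ge0 ?powR_ge0// subr_ge0 ltW.
have main A : A = E \/ A = ~` E -> nu mu (ball x r `&` A) <= nu mu (ball x r `\` A) ->
    (((nu mu (ball x r `&` A) / nu mu (ball x r)) `^ (1 - theta / Q))%:E <=
      (K * (1 - theta) * r `^ theta)%:E * X')%E.
  by move=> AE sm; exact: (perimeter_ge_small_part hCmu hCP htauP mu_reg mu_dbl mu_PI
    th C01 Q1 lmb mE AE r0 sm).
rewrite /v; case: (leP (nu mu (ball x r `&` E)) (nu mu (ball x r `\` E))) => sm.
  by apply: main => //; left.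
have := main (~` E) (or_intror erefl); rewrite (setDE _ (~` E)) setCK -setDE; apply.
exact: ltW.
Qed.
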